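(* Assume $\|X\|/p\le\lambda\le 2\bar\lambda$ with $\bar\lambda=2\|X\|\sqrt{\log p}$, and that there are constants $A_1,A_2,A_3>0$ and $A_4>1$ (not depending on $p$) such that $A_1p^{-A_3}\pi_p(s-1)\le\pi_p(s)\le A_2p^{-A_4}\pi_p(s-1)$ for $s=1,\dots,p$. Then for every $c_0>0$ and any sequence $s_n\le p^a$ with $s_n\lambda\sqrt{\log p}/\|X\|\to0$ and $a<A_4-1$, \[ \sup\ \mathbb E_{\beta^0}\Pi\big(\beta:S_\beta\supset S_{\beta^0},\ S_\beta\ne S_{\beta^0}\ \big|\ Y\big)\to0 \] as $n,p\to\infty$, where the supremum is over all $\beta^0\in\mathbb R^p$ with $\phi(S_0)\ge c_0$, $|S_0|\le s_n$ and $\tilde\psi(S_0)\ge c_0$, $S_0=S_{\beta^0}$.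
   Context: Observations follow $Y=X\beta+\varepsilon$ with $X$ a deterministic real $n\times p$ matrix and $\varepsilon\sim N_n(0,I_n)$. $\mathbb E_{\beta^0}$ denotes expectation when $Y\sim N_n(X\beta^0,I_n)$. $S_\beta=\{i:\beta_i\ne0\}$, $\beta_S=(\beta_i)_{i\in S}$, $\|X\|=\max_i\|X_{\cdot,i}\|_2$. Prior $\Pi$: draw $s\sim\pi_p$ on $\{0,\dots,p\}$, then $S$ uniform among subsets of size $s$, then $\beta_i$, $i\in S$, i.i.d. with density $\frac{\lambda}{2}e^{-\lambda|x|}$, $\beta_i=0$ for $i\notin S$. Posterior $\Pi(B\mid Y)=\int_Be^{-\|Y-X\beta\|_2^2/2}d\Pi(\beta)/\int e^{-\|Y-X\beta\|_2^2/2}d\Pi(\beta)$. $\phi(S)=\inf\{\|X\beta\|_2|S|^{1/2}/(\|X\|\|\beta_S\|_1):\|\beta_{S^c}\|_1\le7\|\beta_S\|_1,\beta_S\ne0\}$; $\tilde\phi(s)=\inf\{\|X\beta\|_2/(\|X\|\|\beta\|_2):0\ne|S_\beta|\le s\}$; $\tilde\psi(S)=\tilde\phi\big((2+\frac{3}{A_4}+\frac{33}{\phi(S)^2}\frac{\lambda}{\bar\lambda})|S|\big)$. Asymptotics: $n,p\to\infty$ with $X,\lambda,\pi_p$ depending on $n,p$ subject to the assumptions (constants $A_i$, $a$ fixed). *)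

(* Defs.v *)
From HB Require Import structures.
From mathcomp Require Import all_boot all_order all_algebra.
From mathcomp Require Import all_classical all_reals all_analysis.
Set Implicit Arguments. Unset Strict Implicit. Unset Printing Implicit Defensive.
Import Order.TTheory GRing.Theory Num.Theory.
Import numFieldNormedType.Exports.
Local Open Scope classical_set_scope.
Local Open Scope ring_scope.

Section Defs.
Variable R : realType.

Definition supp (p : nat) (b : 'I_p -> R) : {set 'I_p} := [set i | b i != 0].

Definition mxv (n p : nat) (X : 'M[R]_(n, p)) (b : 'I_p -> R) (j : 'I_n) : R :=
  \sum_(i < p) X j i * b i.

Definition l2sq (n : nat) (v : 'I_n -> R) : R := \sum_(j < n) v j ^+ 2.
Definition l2 (n : nat) (v : 'I_n -> R) : R := Num.sqrt (l2sq v).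
Definition l1on (p : nat) (S : {set 'I_p}) (b : 'I_p -> R) : R :=
  \sum_(i in S) `|b i|.

Definition colnorm (n p : nat) (X : 'M[R]_(n, p)) : R :=
  \big[Num.max/0]_(i < p) Num.sqrt (\sum_(j < n) X j i ^+ 2).

(* compatibility number phi(S), an infimum in the extended reals
   (inf of the empty set = +oo) *)
Definition phiS (n p : nat) (X : 'M[R]_(n, p)) (S : {set 'I_p}) : \bar R :=
  ereal_inf [set ((l2 (mxv X b) * Num.sqrt (#|S|%:R))
                  / (colnorm X * l1on S b))%:E
            | b in [set b : 'I_p -> R |
                    (l1on (~: S) b <= 7 * l1on S b) /\ l1on S b != 0]].

Definition phit (n p : nat) (X : 'M[R]_(n, p)) (s : R) : \bar R :=
  ereal_inf [set (l2 (mxv X b) / (colnorm X * l2 b))%:E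
            | b in [set b : 'I_p -> R |
                    (0 < #|supp b|)%N /\ (#|supp b|%:R <= s)]].

Definition lambar (n p : nat) (X : 'M[R]_(n, p)) : R :=
  2 * colnorm X * Num.sqrt (ln (p%:R)).

Definition psit (n p : nat) (X : 'M[R]_(n, p)) (lam A4 : R) (S : {set 'I_p})
  : \bar R :=
  phit X ((2 + 3 / A4 + 33 / (fine (phiS X S)) ^+ 2 * (lam / lambar X))
          * #|S|%:R).

Fixpoint itint (I : finType) (dens : I -> R -> R) (s : seq I)
    (h : (I -> R) -> \bar R) (b : I -> R) : \bar R :=
  match s with
  | [::] => h b
  | i :: s' => (\int[@lebesgue_measure R]_x
                  ((dens i x)%:E * itint dens s' h
                        (fun j => if j == i then x else b j)))%E
  end.

Definition laplace (lam x : R) : R := lam / 2 * expR (- (lam * `|x|)).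

(* integral of g >= 0 against the prior Pi (given pi_p : nat -> R and lambda):
   sum over supports S of pi_p(|S|)/C(p,|S|) times the integral of g over
   beta_S with iid Laplace coordinates and beta_{S^c} = 0 *)
Definition prior_int (p : nat) (pi : nat -> R) (lam : R)
    (g : ('I_p -> R) -> \bar R) : \bar R :=
  (\sum_(S : {set 'I_p})
     ((pi #|S| / 'C(p, #|S|)%:R)%:E
      * itint (fun _ => laplace lam) (enum S) g (fun _ => 0%R)))%E.

Definition lik (n p : nat) (X : 'M[R]_(n, p)) (Y : 'I_n -> R) (b : 'I_p -> R)
  : R := expR (- (l2sq (fun j => Y j - mxv X b j) / 2)).

Definition posterior (n p : nat) (X : 'M[R]_(n, p)) (pi : nat -> R) (lam : R)
    (B : set ('I_p -> R)) (Y : 'I_n -> R) : R :=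
  fine (prior_int pi lam (fun b => ((\1_B b : R) * lik X Y b)%:E))
  / fine (prior_int pi lam (fun b => (lik X Y b)%:E)).

Definition gauss_exp (n p : nat) (X : 'M[R]_(n, p)) (b0 : 'I_p -> R)
    (f : ('I_n -> R) -> \bar R) : \bar R :=
  itint (fun j y => normal_pdf (mxv X b0 j) 1 y) (enum 'I_n) f (fun _ => 0).

End Defs.

(* Main.v *)
Require Import Defs.
From HB Require Import structures.
From mathcomp Require Import all_boot all_order all_algebra.
From mathcomp Require Import all_classical all_reals all_analysis.
From mathcomp Require Import measurable_realfun ring lra.

(* Compare each model S strictly containing S0 = supp b0 with the single model
   S0.  Regressing the columns in T = S \ S0 on those in S0 leaves, for beta
   supported on T, a residual q = residv beta orthogonal to the columns in S0.
   Translating the S0-coordinates by the regression coefficients m = coefs beta,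
   at the price exp(lam |m|_1) in the Laplace prior, bounds the Bayes factor of S
   against S0 by the Laplace integral over beta of
     exp(lam |m|_1) exp(<Y, q> - |q|^2 / 2),
   and the second factor has expectation 1 under b0.
   The cost exp(lam |m|_1) is harmless: if |beta|_1 >= 2 |m|_1 the prior density
   of beta absorbs it; otherwise the compatibility condition gives
   |m|_1 <= sqrt(s0) |q| / (c0 ||X||).  On the event that all <Y, residual of
   column i> are at most lambar X, this makes the whole exponent nonpositive as
   soon as |q| >= 16 sqrt(s0 log p) / c0, while for smaller |q| one gets
   lam |m|_1 = O(s0 lam sqrt(log p) / ||X||) = o(1).
   Summing over S, with C(s0 + m, m) <= (s0 + 1)^m, gives a geometric series of
   ratio O((s0 + 1) p^(-A4)) = O(1 / p). *)

Set Implicit Arguments. Unset Strict Implicit. Unset Printing Implicit Defensive.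

Import Order.TTheory GRing.Theory Num.Theory.
Import numFieldNormedType.Exports.
Local Open Scope classical_set_scope.
Local Open Scope ring_scope.

(** * Iterated integrals *)

Section MonotoneIntegral.
Import HBNNSimple.

(** The integral of a nonnegative function is a supremum over the simple functions below it, so it
    is monotone for arbitrary functions. This covers the posterior as a function of [Y], whose
    measurability is never established. *)
Lemma ge0_le_integralT d (T : measurableType d) (R : realType)
    (mu : {measure set T -> \bar R}) (f g : T -> \bar R) :
  (forall x, 0 <= f x)%E -> (forall x, f x <= g x)%E ->
  (\int[mu]_x f x <= \int[mu]_x g x)%E.
Proof.
move=> f0 fg; have g0 x : (0 <= g x)%E by exact: le_trans (fg x).
rewrite !ge0_integralTE//; apply: ereal_sup_le => _ [h hf <-].
by exists h => // x; apply: le_trans (fg x); exact: hf.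
Qed.

End MonotoneIntegral.

(** The image of Lebesgue measure under a translation agrees with it on half-open intervals, hence
    everywhere by uniqueness. *)
Lemma ge0_integral_translation (R : realType) (c : R) (f : R -> \bar R) :
  measurable_fun [set: R] f -> (forall x, 0 <= f x)%E ->
  (\int[@lebesgue_measure R]_x f ((x : R) + c)%R = \int[@lebesgue_measure R]_x f x)%E.
Proof.
move=> mf f0.
pose phi : measurableTypeR R -> measurableTypeR R := fun x => x + c.
have mphi : measurable_fun setT phi by exact: measurable_funD.
have := @ge0_integral_pushforward _ _ _ _ R phi mphi (@lebesgue_measure R)
  setT f measurableT mf (fun x _ => f0 x).
rewrite preimage_setT => <-.
apply: eq_measure_integral => A mA _; apply/esym.
apply: (@lebesgue_measure_unique R (pushforward (@lebesgue_measure R) phi)) => //.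
move=> _ [[a b]] _ <-; rewrite /pushforward /=.
rewrite [RHS](_ : _ = lebesgue_measure `](a - c), (b - c)]%classic); last first.
  congr (lebesgue_measure _); apply/seteqP.
  by split => x /=; rewrite !in_itv/= /phi ltrBlDr lerBrDr.
rewrite !lebesgue_measure_itv/= !lte_fin ltrD2r -!EFinB.
by rewrite (_ : b - c - (a - c) = b - a)//; ring.
Qed.

Section IteratedIntegral.
Context (R : realType).
Local Notation mu := (@lebesgue_measure R).

Definition upd (I : eqType) (b : I -> R) (i : I) (x : R) : I -> R :=
  fun j => if j == i then x else b j.

Definition cmeas d (T : measurableType d) (I : Type) (f : T -> I -> R) :=
  forall i, measurable_fun [set: T] (f ^~ i).

(* Joint measurability without putting a sigma-algebra on [I -> R]. *)
Definition nice (I : Type) (h : (I -> R) -> \bar R) :=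
  forall d (T : measurableType d) (f : T -> I -> R), cmeas f ->
    measurable_fun [set: T] (fun t => h (f t)).

Definition nice2 (I J : Type) (h : (I -> R) -> (J -> R) -> \bar R) :=
  forall d (T : measurableType d) (f : T -> I -> R) (g : T -> J -> R),
    cmeas f -> cmeas g -> measurable_fun [set: T] (fun t => h (f t) (g t)).

Lemma nice2l (I J : Type) (h : (I -> R) -> (J -> R) -> \bar R) b :
  nice2 h -> nice (fun a => h a b).
Proof. by move=> nh d T f cf; apply: nh => // i; exact: measurable_cst. Qed.

Lemma nice2r (I J : Type) (h : (I -> R) -> (J -> R) -> \bar R) a :
  nice2 h -> nice (h a).
Proof. by move=> nh d T f cf; apply: nh => // i; exact: measurable_cst. Qed.

Lemma cmeas_upd d (T : measurableType d) (I : eqType) (f : T -> I -> R) i :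
  cmeas f -> cmeas (fun tx : T * R => upd (f tx.1) i tx.2).
Proof.
move=> cf j; rewrite /upd; case: (j == i); first exact: measurable_snd.
by apply: (measurableT_comp (cf j)); exact: measurable_fst.
Qed.

Lemma cmeas_upd1 (I : eqType) (b : I -> R) i : cmeas (fun x : R => upd b i x).
Proof.
by move=> j; rewrite /upd; case: (j == i); [exact: measurable_id|exact: measurable_cst].
Qed.

Lemma nice_upd (I : eqType) h (b : I -> R) i :
  nice h -> measurable_fun [set: R] (fun x => h (upd b i x)).
Proof. by move=> nh; apply: nh; exact: cmeas_upd1. Qed.

(** * Calculus of iterated integrals over a list of coordinates *)

Section Itint.
Context (I : finType) (dens : I -> R -> R).
Hypothesis dens_ge0 : forall i x, 0 <= dens i x.
Hypothesis mdens : forall i, measurable_fun [set: R] (dens i).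
Let mEdens i : measurable_fun [set: R] (fun x => (dens i x)%:E).
Proof. exact/measurable_EFinP. Qed.

Implicit Types (s : seq I) (h : (I -> R) -> \bar R) (b : I -> R).

Lemma itint_cons i s h b :
  (itint dens (i :: s) h b =
   \int[mu]_x ((dens i x)%:E * itint dens s h (upd b i x)))%E.
Proof. by []. Qed.

Lemma itint_cat s1 s2 h b :
  itint dens (s1 ++ s2) h b = itint dens s1 (itint dens s2 h) b.
Proof.
elim: s1 b => // i s1 IH b; rewrite cat_cons !itint_cons.
by apply: eq_integral => x _; rewrite IH.
Qed.

(** Only points that agree with [b] off [s] are ever evaluated; for [b = 0] these are the points
    supported in [s]. The hypotheses here and in the next two lemmas are restricted to them. *)
Lemma eq_itint s h1 h2 b :
  (forall b', (forall j, j \notin s -> b' j = b j) -> h1 b' = h2 b') ->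
  itint dens s h1 b = itint dens s h2 b.
Proof.
elim: s b => [|i s IH] b H; first exact: H.
rewrite !itint_cons; apply: eq_integral => x _; rewrite IH// => b' Hb'.
apply: H => j; rewrite inE negb_or => /andP[ji js].
by rewrite Hb'// /upd (negbTE ji).
Qed.

Lemma itint_ge0 s h b :
  (forall b', (forall j, j \notin s -> b' j = b j) -> 0 <= h b')%E ->
  (0 <= itint dens s h b)%E.
Proof.
elim: s b => [|i s IH] b H; first exact: H.
rewrite itint_cons; apply: integral_ge0 => x _.
rewrite mule_ge0 ?lee_fin// IH// => b' Hb'.
apply: H => j; rewrite inE negb_or => /andP[ji js].
by rewrite Hb'// /upd (negbTE ji).
Qed.

Lemma le_itint s h1 h2 b :
  (forall b', (forall j, j \notin s -> b' j = b j) -> 0 <= h1 b')%E ->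
  (forall b', (forall j, j \notin s -> b' j = b j) -> h1 b' <= h2 b')%E ->
  (itint dens s h1 b <= itint dens s h2 b)%E.
Proof.
elim: s b => [|i s IH] b H0 H; first exact: H.
have off x b' : (forall j, j \notin s -> b' j = upd b i x j) ->
    forall j, j \notin i :: s -> b' j = b j.
  move=> Hb' j; rewrite inE negb_or => /andP[ji js].
  by rewrite Hb'// /upd (negbTE ji).
rewrite !itint_cons; apply: ge0_le_integralT => x.
  by rewrite mule_ge0 ?lee_fin// itint_ge0// => b' /off; exact: H0.
by rewrite lee_wpmul2l ?lee_fin// IH// => b' /off; [exact: H0|exact: H].
Qed.

(** Each induction step is Tonelli measurability on [T * R]. The argument [a] carries parameters
    that are not integrated, as the exchanges of integrals below require. *)
Lemma nice2_itint (J : Type) s (H : (J -> R) -> (I -> R) -> \bar R) :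
  (forall a b, 0 <= H a b)%E -> nice2 H ->
  nice2 (fun a b => itint dens s (H a) b).
Proof.
move=> H0 nH; elim: s => [//|i s IH] d T f g cf cg.
pose F (tx : T * R) :=
  ((dens i tx.2)%:E * itint dens s (H (f tx.1)) (upd (g tx.1) i tx.2))%E.
have F0 tx : (0 <= F tx)%E by rewrite mule_ge0 ?lee_fin// itint_ge0.
suff mF : measurable_fun [set: T * R] F.
  exact: (@measurable_fun_fubini_tonelli_F _ _ T (measurableTypeR R) R mu F).
apply: emeasurable_funM.
  apply/measurable_EFinP; apply: (measurableT_comp (mdens i)).
  exact: measurable_snd.
apply: (IH _ _ (fun tx : T * R => f tx.1)); last exact: cmeas_upd.
by move=> j; apply: (measurableT_comp (cf j)); exact: measurable_fst.
Qed.

Lemma nice_itint s h : (forall b, 0 <= h b)%E -> nice h -> nice (itint dens s h).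
Proof.
move=> h0 nh d T f cf.
apply: (@nice2_itint void s (fun=> h) _ _ _ _ (fun _ _ => 0)) => //.
by move=> d' T' f' g' _; exact: nh.
Qed.

Lemma measurable_itint_upd s h b i : (forall b, 0 <= h b)%E -> nice h ->
  measurable_fun [set: R] (fun x => (dens i x)%:E * itint dens s h (upd b i x))%E.
Proof.
move=> h0 nh; apply: emeasurable_funM; first exact/measurable_EFinP.
by apply: nice_upd; exact: nice_itint.
Qed.

Lemma itintZl s h (k : \bar R) b : (0 <= k)%E -> (forall b, 0 <= h b)%E ->
  nice h -> (itint dens s (fun b => k * h b) b = k * itint dens s h b)%E.
Proof.
move=> k0 h0 nh; elim: s b => // i s IH b; rewrite !itint_cons.
under eq_integral do rewrite IH muleCA.
rewrite ge0_integralZl//; first exact: measurable_itint_upd.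
by move=> x _; rewrite mule_ge0 ?lee_fin// itint_ge0.
Qed.

Lemma itintD s h1 h2 b : (forall b, 0 <= h1 b)%E -> (forall b, 0 <= h2 b)%E ->
  nice h1 -> nice h2 ->
  (itint dens s (fun b => h1 b + h2 b) b
   = itint dens s h1 b + itint dens s h2 b)%E.
Proof.
move=> h10 h20 n1 n2; elim: s b => // i s IH b; rewrite !itint_cons.
under eq_integral do rewrite IH ge0_muleDr ?itint_ge0//.
rewrite ge0_integralD//; try exact: measurable_itint_upd.
- by move=> x _; rewrite mule_ge0 ?lee_fin// itint_ge0.
- by move=> x _; rewrite mule_ge0 ?lee_fin// itint_ge0.
Qed.

Lemma nice_sum (J : Type) (r : seq J) (P : pred J) (h : J -> (I -> R) -> \bar R) :
  (forall k, nice (h k)) -> nice (fun b => \sum_(k <- r | P k) h k b)%E.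
Proof.
move=> nh d T f cf; under eq_fun do rewrite -big_filter.
by apply: emeasurable_sum => k; exact: nh.
Qed.

Lemma itint_sum (J : Type) (r : seq J) (P : pred J) s
    (h : J -> (I -> R) -> \bar R) b :
  (forall k b, 0 <= h k b)%E -> (forall k, nice (h k)) ->
  (itint dens s (fun b => \sum_(k <- r | P k) h k b) b
   = \sum_(k <- r | P k) itint dens s (h k) b)%E.
Proof.
move=> h0 nh; elim: r => [|k r IH].
  rewrite big_nil; under eq_itint do rewrite big_nil.
  elim: s b => // i s IHs b; rewrite itint_cons.
  by under eq_integral do rewrite IHs mule0; rewrite integral0.
rewrite big_cons; under eq_itint do rewrite big_cons.
case: (P k) => //; rewrite itintD ?IH//; last exact: nice_sum.
by move=> b'; exact: sume_ge0.
Qed.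

(** Tonelli, moving the outer integral through [s] one coordinate at a time. The real parameter is
    encoded as a point of [unit -> R] so that [nice2] applies to it. *)
Lemma itint_integral s (d1 : R -> R) (G : R -> (I -> R) -> \bar R) b :
  (forall x, 0 <= d1 x) -> measurable_fun [set: R] d1 ->
  (forall x b, 0 <= G x b)%E ->
  nice2 (fun (a : unit -> R) b => G (a tt) b) ->
  (\int[mu]_x ((d1 x)%:E * itint dens s (G x) b)
   = itint dens s (fun b => \int[mu]_x ((d1 x)%:E * G x b)) b)%E.
Proof.
move=> d10 md1 G0 nG.
have nGs s' : nice2 (fun (a : unit -> R) => itint dens s' (G (a tt))).
  exact: (@nice2_itint unit s' (fun (a : unit -> R) => G (a tt))).
elim: s b => // j s IH b; rewrite [RHS]itint_cons.
have mEd1 : measurable_fun [set: R] (fun x => (d1 x)%:E).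
  exact/measurable_EFinP.
pose F (xy : R * R) := ((d1 xy.1)%:E *
  ((dens j xy.2)%:E * itint dens s (G xy.1) (upd b j xy.2)))%E.
have mI : measurable_fun [set: R * R]
    (fun xy => itint dens s (G xy.1) (upd b j xy.2)).
  apply: (nGs s _ _ (fun (xy : R * R) (_ : unit) => xy.1)
    (fun (xy : R * R) => upd b j xy.2)).
    by move=> _; exact: measurable_fst.
  move=> i; rewrite /upd; case: (i == j); last exact: measurable_cst.
  exact: measurable_snd.
have I0 x y : (0 <= itint dens s (G x) (upd b j y))%E by exact: itint_ge0.
transitivity (\int[mu]_x \int[mu]_y F (x, y))%E.
  apply: eq_integral => x _; rewrite itint_cons -ge0_integralZl//.
  - apply: emeasurable_funM; first exact: mEdens.
    by have := measurableT_comp mI (pair1_measurable x).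
  - by move=> y _; rewrite mule_ge0 ?lee_fin.
  - by rewrite lee_fin.
rewrite fubini_tonelli//; last 2 first.
- apply: emeasurable_funM.
    apply/measurable_EFinP; apply: (measurableT_comp md1).
    exact: measurable_fst.
  apply: emeasurable_funM => //.
  apply/measurable_EFinP; apply: (measurableT_comp (mdens j)).
  exact: measurable_snd.
- by move=> [x y]; rewrite /F !mule_ge0 ?lee_fin.
apply: eq_integral => y _; rewrite -IH /F/=.
under eq_integral do rewrite muleCA.
rewrite ge0_integralZl//.
- apply: emeasurable_funM; first exact: mEd1.
  by have := measurableT_comp mI (pair2_measurable y).
- by move=> x _; rewrite mule_ge0 ?lee_fin.
- by rewrite lee_fin.
Qed.

Lemma itint_swap2 i j s h b : (forall b, 0 <= h b)%E -> nice h -> i != j ->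
  itint dens (i :: j :: s) h b = itint dens (j :: i :: s) h b.
Proof.
move=> h0 nh ij.
have nG : nice2 (fun (a : unit -> R) b => itint dens s h (upd b i (a tt))).
  move=> d T f g cf cg; apply: nice_itint => // k.
  by rewrite /upd; case: (k == i); [exact: cf|exact: cg].
have := @itint_integral [:: j] (dens i)
  (fun x b => itint dens s h (upd b i x)) b
  (dens_ge0 i) (mdens i) _ nG.
rewrite /= => E; rewrite /= -E; last by move=> x b'; exact: itint_ge0.
apply: eq_integral => x _; congr (_ * _)%E; apply: eq_integral => y _.
congr (_ * itint _ _ _ _)%E; apply/funext => k; rewrite /upd.
by have [->|//] := eqVneq k j; rewrite eq_sym (negbTE ij).
Qed.

Lemma perm_itint s1 s2 h b : (forall b, 0 <= h b)%E -> nice h ->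
  uniq s1 -> perm_eq s1 s2 -> itint dens s1 h b = itint dens s2 h b.
Proof.
move=> h0 nh; elim: s1 s2 b => [|i s1 IH] s2 b.
  by move=> _; rewrite perm_sym => /perm_nilP ->.
move=> /= /andP[is1 us1] ps.
have : i \in s2 by rewrite -(perm_mem ps) mem_head.
move=> is2; case: (splitPr is2) ps => r1 r2 ps.
have {}ps : perm_eq s1 (r1 ++ r2).
  rewrite -(perm_cons i); apply: (perm_trans ps).
  by rewrite perm_catC/= perm_cons perm_catC.
have ir1 : i \notin r1.
  by move: is1; rewrite (perm_mem ps) mem_cat negb_or => /andP[].
transitivity (itint dens (i :: r1 ++ r2) h b).
  by rewrite !itint_cons; apply: eq_integral => x _; rewrite (IH (r1 ++ r2)).
(* Carry [i] past the entries of [r1] by adjacent transpositions. *)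
elim: r1 ir1 b {ps} => // j r1 IHr; rewrite inE negb_or => /andP[ij ir1] b.
rewrite !cat_cons itint_swap2// !(itint_cons j).
by apply: eq_integral => x _; rewrite IHr.
Qed.

(* Both integrands are compared along the translation by [c] of the
   coordinates in [s]; the base points [b1] and [b2] are unrelated. *)
Lemma itint_shift s h1 h2 (c K : I -> R) (k : R) b1 b2 :
  (forall b, 0 <= h1 b)%E -> nice h1 ->
  (forall b, 0 <= h2 b)%E -> nice h2 ->
  (forall i, 0 <= K i) -> 0 <= k -> uniq s ->
  (forall i x, dens i (x + c i) <= K i * dens i x) ->
  (forall b, h1 (fun j => if j \in s then (b j + c j)%R else b1 j)
             <= k%:E * h2 (fun j => if j \in s then b j else b2 j))%E ->
  (itint dens s h1 b1 <= (k * \prod_(i <- s) K i)%:E * itint dens s h2 b2)%E.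
Proof.
move=> h10 n1 h20 n2 K0 k0 + Kdens.
elim: s b1 b2 => [|i s IH] b1 b2.
  by move=> _ /(_ (fun=> 0)) /=; rewrite big_nil mulr1.
rewrite cons_uniq => /andP[iNs us] H; rewrite !itint_cons.
have P0 : 0 <= k * \prod_(j <- s) K j by rewrite mulr_ge0// prodr_ge0.
rewrite -(@ge0_integral_translation R (c i)); last 2 first.
- exact: measurable_itint_upd.
- by move=> x; rewrite mule_ge0 ?lee_fin// itint_ge0.
rewrite -ge0_integralZl//; last 3 first.
- exact: measurable_itint_upd.
- by move=> x _; rewrite mule_ge0 ?lee_fin// itint_ge0.
- by rewrite lee_fin big_cons mulrCA mulr_ge0.
apply: ge0_le_integralT => x.
  by rewrite mule_ge0 ?lee_fin// itint_ge0.
rewrite [X in (_ <= X)%E](_ : _ = (K i * dens i x)%:E *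
  ((k * \prod_(j <- s) K j)%:E * itint dens s h2 (upd b2 i x)))%E; last first.
  by rewrite big_cons !muleA -!EFinM; congr (_%:E * _)%E; ring.
apply: lee_pmul; rewrite ?lee_fin//; first by rewrite itint_ge0.
apply: IH => // b; have := H (upd b i x).
rewrite (_ : (fun j => if j \in i :: s then upd b i x j + c j else b1 j)
  = (fun j => if j \in s then b j + c j else upd b1 i (x + c i) j)); last first.
  apply/funext => j; rewrite inE /upd.
  by have [->|] := eqVneq j i; rewrite /= ?(negbTE iNs).
rewrite (_ : (fun j => if j \in i :: s then upd b i x j else b2 j)
  = (fun j => if j \in s then b j else upd b2 i x j))//.
apply/funext => j; rewrite inE /upd.
by have [->|] := eqVneq j i; rewrite /= ?(negbTE iNs).
Qed.

(** The integrand factorizes, so coordinates in [s] are integrated one by one against their bounds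
    [c i], while the others stay frozen at [b]. *)
Lemma itint_prod_le s (g : I -> R -> R) (c : I -> R) b :
  (forall i x, 0 <= g i x) -> (forall i, measurable_fun [set: R] (g i)) ->
  (forall i, 0 <= c i) -> uniq s ->
  (forall i, i \in s -> \int[mu]_x (dens i x * g i x)%:E <= (c i)%:E)%E ->
  (itint dens s (fun b => (\prod_i g i (b i))%:E) b
   <= (\prod_(i <- s) c i * \prod_(i | i \notin s) g i (b i))%:E)%E.
Proof.
move=> g0 mg c0; elim: s b => [|i s IH] b.
  by move=> _ _; rewrite /= big_nil mul1r.
rewrite cons_uniq => /andP[iNs us] H; rewrite itint_cons.
have E x : \prod_(j | j \notin s) g j (upd b i x j)
    = g i x * \prod_(j | j \notin i :: s) g j (b j).
  rewrite (bigD1 i)//= /upd eqxx; congr (_ * _); apply: eq_big => j.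
    by rewrite inE negb_or andbC.
  by move=> /andP[_ /negbTE ->].
set P := \prod_(j | j \notin i :: s) g j (b j).
have P0 : 0 <= P by exact: prodr_ge0.
have Q0 : 0 <= \prod_(j <- s) c j by exact: prodr_ge0.
apply: (@le_trans _ _
    (\int[mu]_x ((P * \prod_(j <- s) c j)%:E * (dens i x * g i x)%:E))%E).
  apply: ge0_le_integralT => x.
    rewrite mule_ge0 ?lee_fin// itint_ge0// => b' _.
    by rewrite lee_fin prodr_ge0.
  apply: (@le_trans _ _ ((dens i x)%:E *
      (\prod_(j <- s) c j * \prod_(j | j \notin s) g j (upd b i x j))%:E)%E).
    rewrite lee_wpmul2l ?lee_fin//; apply: IH => // j js.
    by apply: H; rewrite inE js orbT.
  by rewrite E -/P -!EFinM lee_fin le_eqVlt; apply/orP; left; apply/eqP; ring.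
have mdg : measurable_fun [set: R] (fun x => (dens i x * g i x)%:E).
  by apply/measurable_EFinP; exact: measurable_funM.
rewrite ge0_integralZl//; last 2 first.
- by move=> x _; rewrite lee_fin mulr_ge0.
- by rewrite lee_fin mulr_ge0.
apply: (@le_trans _ _ ((P * \prod_(j <- s) c j)%:E * (c i)%:E)%E).
  by rewrite lee_wpmul2l ?lee_fin ?mulr_ge0// H// mem_head.
by rewrite -EFinM big_cons lee_fin le_eqVlt; apply/orP; left; apply/eqP; ring.
Qed.

End Itint.

(** Tonelli for two blocks of variables; it allows the expectation in [Y] to be taken before the
    prior integral in [beta]. *)
Lemma itint_itint (I J : finType) (dI : I -> R -> R) (dJ : J -> R -> R)
    (sI : seq I) (sJ : seq J) (H : (I -> R) -> (J -> R) -> \bar R) a b :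
  (forall i x, 0 <= dI i x) -> (forall i, measurable_fun [set: R] (dI i)) ->
  (forall j x, 0 <= dJ j x) -> (forall j, measurable_fun [set: R] (dJ j)) ->
  (forall a b, 0 <= H a b)%E -> nice2 H ->
  itint dI sI (fun a => itint dJ sJ (H a) b) a
  = itint dJ sJ (fun b => itint dI sI (H ^~ b) a) b.
Proof.
move=> dI0 mdI dJ0 mdJ H0 nH; elim: sI a => // i sI IH a; rewrite itint_cons.
under eq_integral do rewrite IH.
rewrite itint_integral//.
  by move=> x b'; exact: itint_ge0.
move=> d T f g cf cg.
pose H' (b : J -> R) (a : I -> R) := H a b.
have : nice2 (fun b => itint dI sI (H' b)).
  apply: nice2_itint => //.
  - by move=> b' a'; exact: H0.
  - by move=> d' T' f' g' cf' cg'; exact: nH.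
apply => // k.
by rewrite /upd; case: (k == i); [exact: cf|exact: measurable_cst].
Qed.

End IteratedIntegral.

(** * Residuals of the regression on a submodel *)

(** The diagonal entries of the Gram matrix of [A *m V] are sums of squares of its entries. *)
Lemma gram_mulmx_eq0 (R : realType) m n q (A : 'M[R]_(m, n)) (V : 'M[R]_(n, q)) :
  A^T *m A *m V = 0 -> A *m V = 0.
Proof.
move=> AAV; apply/matrixP => j c; rewrite mxE.
have : ((A *m V)^T *m (A *m V)) c c = 0.
  by rewrite trmx_mul -mulmxA (mulmxA A^T) AAV mulmx0 mxE.
rewrite mxE; under eq_bigr do rewrite mxE -expr2.
move/eqP; rewrite psumr_eq0 => [/allP/(_ j)|i _]; last exact: sqr_ge0.
by rewrite mem_index_enum => /(_ isT)/=; rewrite sqrf_eq0 => /eqP; rewrite !mxE.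
Qed.

(** Least squares is solvable even for dependent columns. With [A] equal to [X] with the columns
    outside [S] set to zero, whatever [A^T *m A] kills is killed by [A], so the row space of
    [X^T *m A] lies in that of [A^T *m A]. *)
Lemma normal_equations (R : realType) n p (X : 'M[R]_(n, p)) (S : {set 'I_p}) :
  exists M : 'I_p -> 'I_p -> R, forall i k, k \in S ->
    \sum_j X j k * (X j i - \sum_(l in S) X j l * M l i) = 0.
Proof.
pose A : 'M[R]_(n, p) := \matrix_(j, l) (if l \in S then X j l else 0).
have /submxP[D AD] : (X^T *m A <= A^T *m A)%MS.
  by rewrite submxE -mulmxA (gram_mulmx_eq0 (mulmx_coker _)) mulmx0.
have {}AD : A^T *m X = A^T *m (A *m D^T).
  by rewrite -[LHS]trmxK trmx_mul trmxK AD !trmx_mul !trmxK mulmxA.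
exists (fun l i => D i l) => i k kS.
have /matrixP/(_ k i) E : A^T *m (X - A *m D^T) = 0 by rewrite mulmxBr AD subrr.
rewrite mxE [RHS]mxE in E; rewrite -[RHS]E; apply: eq_bigr => j _; rewrite !mxE kS.
congr (_ * (_ - _)).
rewrite [RHS](bigID (mem S))/= [X in _ + X]big1 ?addr0; last first.
  by move=> l /negbTE lS; rewrite !mxE lS mul0r.
by apply: eq_bigr => l lS; rewrite !mxE lS.
Qed.

Section Residuals.
Context (R : realType) (n p : nat) (X : 'M[R]_(n, p)) (S : {set 'I_p}).
Variable M : 'I_p -> 'I_p -> R.
Hypothesis HM : forall i k, k \in S ->
  \sum_j X j k * (X j i - \sum_(l in S) X j l * M l i) = 0.

Definition resid (i : 'I_p) (j : 'I_n) : R := X j i - \sum_(l in S) X j l * M l i.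

Definition residv (b : 'I_p -> R) (j : 'I_n) : R :=
  \sum_(i | i \notin S) b i * resid i j.

Definition dot (u v : 'I_n -> R) : R := \sum_j u j * v j.

(* Regressing [X b_{S^c}] on the columns in [S] leaves
   [residv b = X (b_{S^c} + coefs b)]. *)
Definition coefs (b : 'I_p -> R) (l : 'I_p) : R :=
  - \sum_(i | i \notin S) M l i * b i.

Definition glue (u b : 'I_p -> R) : 'I_p -> R :=
  fun j => if j \in S then u j else b j.

Lemma mxvD (a b : 'I_p -> R) j : mxv X (fun i => a i + b i) j = mxv X a j + mxv X b j.
Proof. by rewrite /mxv -big_split; apply: eq_bigr => i _; rewrite mulrDr. Qed.

Lemma mxv_coefs b j : mxv X (glue (coefs b) b) j = residv b j.
Proof.
rewrite /mxv (bigID (mem S))/= addrC /residv.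
rewrite (eq_bigr (fun i => b i * X j i)); last first.
  by move=> i /negbTE iS; rewrite /glue iS mulrC.
rewrite [X in _ + X](eq_bigr
    (fun l => \sum_(i | i \notin S) - (b i * (X j l * M l i)))); last first.
  move=> l lS; rewrite /glue lS /coefs sumrN mulrN mulr_sumr.
  by congr (- _); apply: eq_bigr => i _; ring.
rewrite exchange_big -big_split/=; apply: eq_bigr => i _.
by rewrite sumrN -mulr_sumr -mulrBr.
Qed.

Lemma dot_resid a i : (forall k, k \notin S -> a k = 0) ->
  dot (mxv X a) (resid i) = 0.
Proof.
move=> aS; rewrite /dot /mxv.
under eq_bigr do rewrite mulr_suml.
rewrite exchange_big big1//= => k _.
have [kS|kS] := boolP (k \in S); last first.
  by rewrite big1// => j _; rewrite aS// mulr0 mul0r.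
rewrite (eq_bigr (fun j => a k * (X j k * resid i j))); last first.
  by move=> j _; ring.
by rewrite -mulr_sumr HM// mulr0.
Qed.

Lemma dot_residvE u b :
  dot u (residv b) = \sum_(i | i \notin S) b i * dot u (resid i).
Proof.
rewrite /dot /residv; under eq_bigr do rewrite mulr_sumr.
rewrite exchange_big; apply: eq_bigr => i _; rewrite mulr_sumr.
by apply: eq_bigr => j _; ring.
Qed.

Lemma dot_residv a b : (forall k, k \notin S -> a k = 0) ->
  dot (mxv X a) (residv b) = 0.
Proof.
by move=> aS; rewrite dot_residvE big1// => i _; rewrite dot_resid// mulr0.
Qed.

Lemma colnorm_ge0 : 0 <= colnorm X.
Proof.
rewrite /colnorm; elim/big_ind: _ => // x y x0 y0.
by rewrite le_max x0.
Qed.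

Lemma col_le_colnorm i : \sum_j X j i ^+ 2 <= colnorm X ^+ 2.
Proof.
have s0 : 0 <= \sum_j X j i ^+ 2 by apply: sumr_ge0 => j _; exact: sqr_ge0.
rewrite -(sqr_sqrtr s0) lerXn2r ?nnegrE ?sqrtr_ge0 ?colnorm_ge0//.
exact: (le_bigmax _ (fun i => Num.sqrt (\sum_j X j i ^+ 2)) i).
Qed.

(** Pythagoras: column [i] is its fitted part, a combination of the columns in [S], plus the
    orthogonal residual. *)
Lemma l2sq_resid i : l2sq (resid i) <= colnorm X ^+ 2.
Proof.
apply: le_trans (col_le_colnorm i).
pose a l := if l \in S then M l i else 0.
have aE j : mxv X a j = \sum_(l in S) X j l * M l i.
  rewrite /mxv (bigID (mem S))/= [X in _ + X]big1 ?addr0; last first.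
    by move=> l /negbTE lS; rewrite /a lS mulr0.
  by apply: eq_bigr => l lS; rewrite /a lS.
have d0 : dot (mxv X a) (resid i) = 0.
  by apply: dot_resid => k /negbTE kS; rewrite /a kS.
suff -> : \sum_j X j i ^+ 2
    = l2sq (resid i) + l2sq (mxv X a) + dot (mxv X a) (resid i) *+ 2.
  by rewrite d0 mul0rn addr0 lerDl sumr_ge0// => j _; exact: sqr_ge0.
rewrite /l2sq /dot -sumrMnl -!big_split; apply: eq_bigr => j _ /=.
by rewrite /resid aE; ring.
Qed.

Lemma l2sq_ge0 m (v : 'I_m -> R) : 0 <= l2sq v.
Proof. by apply: sumr_ge0 => j _; exact: sqr_ge0. Qed.

Lemma l1on_ge0 (A : {set 'I_p}) b : 0 <= l1on A b :> R.
Proof. by rewrite sumr_ge0. Qed.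

(** After the translation the mean is a combination of the columns in [S] plus [residv b]; the two
    are orthogonal, so the cross term vanishes and the likelihood factorizes. *)
Lemma lik_glue Y u b :
  lik X Y (glue (fun j => u j + coefs b j) b)
  = expR (dot Y (residv b) - l2sq (residv b) / 2) * lik X Y (glue u (fun=> 0)).
Proof.
rewrite /lik -expRD; congr expR.
have E j : mxv X (glue (fun j => u j + coefs b j) b) j
    = mxv X (glue u (fun=> 0)) j + residv b j.
  rewrite -mxv_coefs -mxvD; congr (mxv X _ j); apply/funext => k.
  by rewrite /glue; case: ifP => // _; rewrite add0r.
have d0 : dot (mxv X (glue u (fun=> 0))) (residv b) = 0.
  by apply: dot_residv => k /negbTE kS; rewrite /glue kS.
suff -> : l2sq (fun j => Y j - mxv X (glue (fun j => u j + coefs b j) b) j)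
    = l2sq (fun j => Y j - mxv X (glue u (fun=> 0)) j)
      - dot Y (residv b) *+ 2 + l2sq (residv b)
      + dot (mxv X (glue u (fun=> 0))) (residv b) *+ 2.
  by rewrite d0; field.
rewrite /l2sq /dot -!sumrMnl -sumrN -!big_split; apply: eq_bigr => j _ /=.
by rewrite E; ring.
Qed.

(** The compatibility condition is applied to [glue (coefs b) b], whose image under [X] is the
    residual. *)
Lemma phiS_coefs c0 b : (c0%:E <= phiS X S)%E -> 0 < colnorm X ->
  l1on (~: S) b <= 7 * l1on S (coefs b) -> l1on S (coefs b) != 0 ->
  c0 * (colnorm X * l1on S (coefs b)) <= l2 (residv b) * Num.sqrt #|S|%:R.
Proof.
move=> phi N0 b7 c_neq0.
have SE : l1on S (glue (coefs b) b) = l1on S (coefs b).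
  by apply: eq_bigr => l lS; rewrite /glue lS.
have CE : l1on (~: S) (glue (coefs b) b) = l1on (~: S) b.
  by apply: eq_bigr => l; rewrite inE => /negbTE lS; rewrite /glue lS.
have QE : l2 (mxv X (glue (coefs b) b)) = l2 (residv b).
  by congr (Num.sqrt (l2sq _)); apply/funext => j; exact: mxv_coefs.
have : (c0%:E <= ((l2 (residv b) * Num.sqrt #|S|%:R)
    / (colnorm X * l1on S (coefs b)))%:E)%E.
  apply: le_trans phi _; apply: ereal_inf_lbound => /=.
  by exists (glue (coefs b) b); rewrite /= ?QE ?SE ?CE.
rewrite lee_fin ler_pdivlMr// mulr_gt0// lt_def c_neq0; exact: l1on_ge0.
Qed.

(** On the right, the first factor pays when [b] is long compared with its regression coefficients,
    the summand [expR 1 * expR Z] pays for small residuals, and the summand 1 for large ones. *)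
Lemma shift_cost_le lam c0 Y b :
  let L := lambar X in
  let Z := dot Y (residv b) - l2sq (residv b) / 2 in
  (c0%:E <= phiS X S)%E -> 0 < c0 -> 0 < colnorm X -> 0 < lam -> lam <= 2 * L ->
  (forall i, i \notin S -> `|dot Y (resid i)| <= L) ->
  16 * (#|S|%:R * lam * Num.sqrt (ln p%:R) / colnorm X) <= c0 ^+ 2 ->
  expR (lam * l1on S (coefs b)) * expR Z
  <= expR (lam / 2 * l1on (~: S) b) * (expR 1 * expR Z + 1).
Proof.
move=> L Z phi c0_gt0 N0 lam0 lamL HY small.
set a := l1on S (coefs b); set B := l1on (~: S) b.
have a0 : 0 <= a by exact: l1on_ge0.
have B0 : 0 <= B by exact: l1on_ge0.
have eB : 1 <= expR (lam / 2 * B).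
  by rewrite -expR0 ler_expR mulr_ge0// divr_ge0// ltW.
have e1 : 1 <= expR 1 :> R by rewrite -[leLHS]expR0 ler_expR.
(* If [a * 2 <= B], half of the Laplace rate absorbs the shift. *)
have [aB|Ba] := leP (a * 2) B.
  rewrite mulrDr mulr1 ler_wpDr ?expR_ge0//; apply: ler_pM; rewrite ?expR_ge0//.
    by rewrite ler_expR -mulrA ler_pM2l// mulrC ler_pdivlMr.
  by rewrite ler_peMl// expR_ge0.
have a_gt0 : 0 < a by rewrite -(pmulr_lgt0 _ (ltr0n R 2)) (le_lt_trans B0).
(* Now [B < a * 2], which puts the vector well inside the cone [B <= 7 * a] of the compatibility
   condition. *)
have key := @phiS_coefs c0 b phi N0 _ (lt0r_neq0 a_gt0).
have {}key : c0 * (colnorm X * a) <= l2 (residv b) * Num.sqrt #|S|%:R.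
  by apply: key; rewrite -/a -/B; lra.
set Q := l2 (residv b) in key.
have Q0 : 0 <= Q by exact: sqrtr_ge0.
have QE : l2sq (residv b) = Q ^+ 2 by rewrite sqr_sqrtr// l2sq_ge0.
set N := colnorm X in N0 key small.
set s := Num.sqrt #|S|%:R in key.
set t := Num.sqrt (ln p%:R) in small.
have s0 : 0 <= s by exact: sqrtr_ge0.
have t0 : 0 <= t by exact: sqrtr_ge0.
have sE : #|S|%:R = s ^+ 2 by rewrite sqr_sqrtr.
have LE : L = 2 * N * t by [].
have ZB : Z <= L * B - Q ^+ 2 / 2.
  rewrite /Z QE lerD2r dot_residvE /B /l1on mulr_sumr.
  apply: (le_trans (ler_norm _)); apply: (le_trans (ler_norm_sum _ _ _)).
  rewrite [leRHS](eq_bigl (fun i => i \notin S)); last by move=> i; rewrite inE.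
  apply: ler_sum => i iS; rewrite normrM mulrC ler_wpM2r//; exact: HY.
have L0 : 0 <= L by rewrite LE !mulr_ge0// ltW.
(* Above the threshold, [lam a + L B <= 4 L a = 8 N t a], which compatibility bounds by
   [Q ^+ 2 / 2]; the whole exponent is then nonpositive. *)
have [Qbig|Qsmall] := leP (16 * (s * t)) (c0 * Q).
  apply: (@le_trans _ _ 1); last first.
    apply: (le_trans eB); rewrite ler_peMr ?expR_ge0//.
    by rewrite lerDr mulr_ge0 ?expR_ge0.
  rewrite -expRD -expR0 ler_expR.
  have h1 : lam * a <= 2 * L * a by rewrite ler_wpM2r.
  have h2 : L * B <= L * (a * 2) by rewrite ler_wpM2l// ltW.
  suff : c0 * (8 * (N * t * a)) <= c0 * (Q ^+ 2 / 2).
    by rewrite ler_pM2l// => h3; move: h1 h2 ZB; rewrite LE; lra.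
  have h4 : t * (c0 * (N * a)) <= t * (Q * s) by rewrite ler_wpM2l.
  have h5 : Q * (16 * (s * t)) <= Q * (c0 * Q) by rewrite ler_wpM2l.
  by lra.
(* Below the threshold, [c0 ^+ 2 N lam a <= lam c0 s Q <= 16 s ^+ 2 lam t <= c0 ^+ 2 N], the last
   step by [small]. *)
have h : lam * a <= 1.
  have c2 : 0 < c0 ^+ 2 * N by rewrite mulr_gt0// exprn_gt0.
  rewrite -(ler_pM2l c2) mulr1.
  have h1 : (lam * c0) * (c0 * (N * a)) <= (lam * c0) * (Q * s).
    by rewrite ler_wpM2l// mulr_ge0// ltW.
  have h2 : lam * s * (c0 * Q) <= lam * s * (16 * (s * t)).
    by rewrite ler_wpM2l// ?mulr_ge0// ltW.
  have h3 : N * (16 * (s ^+ 2 * lam * t / N)) <= N * c0 ^+ 2.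
    by rewrite ler_pM2l// -sE.
  have h4 : N * (16 * (s ^+ 2 * lam * t / N)) = 16 * s ^+ 2 * lam * t.
    by field; exact: lt0r_neq0.
  by move: h1 h2 h3; rewrite h4; lra.
apply: (@le_trans _ _ (expR 1 * expR Z)).
  by rewrite ler_pM ?expR_ge0// ler_expR.
apply: (@le_trans _ _ (expR 1 * expR Z + 1)); first by rewrite lerDl.
by rewrite ler_peMl// addr_ge0// mulr_ge0 ?expR_ge0.
Qed.

End Residuals.

(** * Gaussian and Laplace expectations *)

Section Expectations.
Context (R : realType).
Local Notation mu := (@lebesgue_measure R).

(** Completing the square gives a multiple of the normal density centred at [m + v]. *)
Lemma normal_mgf (m v : R) :
  (\int[mu]_x (normal_pdf m 1 x * expR (v * x))%:E
   = (expR (m * v + v ^+ 2 / 2))%:E)%E.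
Proof.
transitivity (\int[mu]_x
    ((expR (m * v + v ^+ 2 / 2))%:E * (normal_pdf (m + v) 1 x)%:E))%E.
  apply: eq_integral => x _; rewrite -EFinM; congr EFin.
  rewrite !normal_pdfE ?oner_neq0// mulrCA -!mulrA; congr (_ * _).
  by rewrite /normal_fun -!expRD; congr expR; field.
rewrite ge0_integralZl_EFin ?expR_ge0//.
- by rewrite integral_normal_pdf mule1.
- by move=> x _; rewrite lee_fin normal_pdf_ge0.
- by apply/measurable_EFinP; exact: measurable_normal_pdf.
Qed.

Lemma laplace_ge0 (lam x : R) : 0 < lam -> 0 <= laplace lam x.
Proof. by move=> l0; rewrite mulr_ge0 ?expR_ge0// divr_ge0// ltW. Qed.

Lemma measurable_laplace (lam : R) : measurable_fun [set: R] (laplace lam).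
Proof.
apply: measurable_funM => //; apply: measurableT_comp => //.
by apply: measurableT_comp => //; exact: measurable_funM.
Qed.

(** The tilt halves the decay rate and keeps the constant [lam / 2], so on each half-line the
    integrand is the exponential density of rate [lam / 2], of mass at most 1. *)
Lemma laplace_tilt (lam : R) : 0 < lam ->
  (\int[mu]_x (laplace lam x * expR (lam / 2 * `|x|))%:E <= 2%:E)%E.
Proof.
move=> lam0; have r0 : 0 < lam / 2 by rewrite divr_gt0.
pose f (x : R) := lam / 2 * expR (- (lam / 2 * `|x|)).
have -> : (\int[mu]_x (laplace lam x * expR (lam / 2 * `|x|))%:E
    = \int[mu]_x (f x)%:E)%E.
  apply: eq_integral => x _; rewrite /laplace -mulrA -expRD; congr (_ * expR _)%:E.
  by field.
have cf : continuous f.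
  move=> x; apply: cvgM; first exact: cvg_cst.
  apply: continuous_comp; last exact: continuous_expR.
  apply: (@continuousN _ R^o); apply: cvgM; first exact: cvg_cst.
  exact: (@norm_continuous R R^o).
rewrite ge0_symfun_integralT//; last 2 first.
- by move=> x; rewrite mulr_ge0 ?expR_ge0// ltW.
- by move=> x; rewrite /f /= normrN.
rewrite -[leRHS]mule1 lee_wpmul2l//.
rewrite -(integral_exponential_pdf r0).
have -> : (\int[mu]_(x in [set x | (0 <= x)%R]) (f x)%:E
    = \int[mu]_(x in [set x | (0 <= x)%R]) (exponential_pdf (lam / 2) x)%:E)%E.
  apply: eq_integral => x; rewrite inE/= => x0.
  by rewrite exponential_pdfE// /f ger0_norm// mulNr.
apply: ge0_subset_integral => //=.
- by rewrite -set_itvcy.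
- by apply/measurable_EFinP; exact: measurable_exponential_pdf.
- by move=> x _; rewrite lee_fin exponential_pdf_ge0// ltW.
Qed.

(** * Measurability of the likelihood and its ingredients *)

Section Measurability.
Context d (T : measurableType d).

Lemma measurable_dot n (u v : T -> 'I_n -> R) : cmeas u -> cmeas v ->
  measurable_fun [set: T] (fun t => dot (u t) (v t)).
Proof. by move=> cu cv; apply: measurable_sum => j; exact: measurable_funM. Qed.

Lemma measurable_l2sq n (u : T -> 'I_n -> R) : cmeas u ->
  measurable_fun [set: T] (fun t => l2sq (u t)).
Proof. by move=> cu; apply: measurable_sum => j; exact: measurable_funX. Qed.

Lemma measurable_l1on p (S : {set 'I_p}) (b : T -> 'I_p -> R) : cmeas b ->
  measurable_fun [set: T] (fun t => l1on S (b t)).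
Proof.
move=> cb; rewrite /l1on; under eq_fun do rewrite -big_filter.
by apply: measurable_sum => j; exact: measurableT_comp.
Qed.

Lemma cmeas_residv n p (X : 'M[R]_(n, p)) S M (b : T -> 'I_p -> R) : cmeas b ->
  cmeas (fun t => residv X S M (b t)).
Proof.
move=> cb j; rewrite /residv; under eq_fun do rewrite -big_filter.
by apply: measurable_sum => i; exact: measurable_funM.
Qed.

Lemma measurable_lik n p (X : 'M[R]_(n, p)) Y (b : T -> 'I_p -> R) : cmeas b ->
  measurable_fun [set: T] (fun t => lik X Y (b t)).
Proof.
move=> cb; apply: measurableT_comp => //; apply: measurableT_comp => //.
apply: measurable_funM => //; apply: measurable_l2sq => j.
apply: measurable_funB => //; apply: measurable_sum => i.
exact: measurable_funM.
Qed.

End Measurability.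

(** With [q = residv b] and a mean [mu] orthogonal to [q], this is the likelihood ratio of the means
    [mu + q] and [mu]. *)
Definition tilt n p (X : 'M[R]_(n, p)) S M (Y : 'I_n -> R) (b : 'I_p -> R) : R :=
  expR (dot Y (residv X S M b) - l2sq (residv X S M b) / 2).

Definition majorant n p (X : 'M[R]_(n, p)) S M lam Y b : R :=
  expR (lam / 2 * l1on (~: S) b) * (expR 1 * tilt X S M Y b + 1).

Lemma nice2_tilt n p (X : 'M[R]_(n, p)) S M :
  nice2 (fun Y b => (tilt X S M Y b)%:E).
Proof.
move=> d T f g cf cg; apply/measurable_EFinP; apply: measurableT_comp => //.
have cr := cmeas_residv X S M cg.
apply: measurable_funB; first exact: measurable_dot.
by apply: measurable_funM => //; exact: measurable_l2sq.
Qed.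

Lemma nice2_majorant n p (X : 'M[R]_(n, p)) S M lam :
  nice2 (fun Y b => (majorant X S M lam Y b)%:E).
Proof.
move=> d T f g cf cg; apply/measurable_EFinP; apply: measurable_funM.
  apply: measurableT_comp => //; apply: measurable_funM => //.
  exact: measurable_l1on.
apply: measurable_funD => //; apply: measurable_funM => //.
by apply/measurable_EFinP; exact: (nice2_tilt X S M).
Qed.

Lemma majorant_ge0 n p (X : 'M[R]_(n, p)) S M lam Y b :
  0 <= majorant X S M lam Y b.
Proof. by rewrite mulr_ge0 ?expR_ge0// addr_ge0// mulr_ge0// expR_ge0. Qed.

(** * Bounds on Gaussian expectations *)

Section Gauss.
Context (n p : nat) (X : 'M[R]_(n, p)) (b0 : 'I_p -> R).

Let pdf_ge0 (j : 'I_n) (y : R) : 0 <= normal_pdf (mxv X b0 j) 1 y.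
Proof. exact: normal_pdf_ge0. Qed.

Let measurable_pdf (j : 'I_n) : measurable_fun [set: R] (normal_pdf (mxv X b0 j) 1).
Proof. exact: measurable_normal_pdf. Qed.

Lemma nice_expR_dot (v : 'I_n -> R) : nice (fun Y => (expR (dot Y v))%:E).
Proof.
move=> d T f cf; apply/measurable_EFinP; apply: measurableT_comp => //.
by apply: measurable_dot => // j; exact: measurable_cst.
Qed.

Lemma gauss_expZl k (h : ('I_n -> R) -> \bar R) : 0 <= k ->
  (forall Y, 0 <= h Y)%E -> nice h ->
  (gauss_exp X b0 (fun Y => k%:E * h Y) = k%:E * gauss_exp X b0 h)%E.
Proof. by move=> k0 h0 nh; exact: itintZl. Qed.

Lemma gauss_expD (h1 h2 : ('I_n -> R) -> \bar R) :
  (forall Y, 0 <= h1 Y)%E -> (forall Y, 0 <= h2 Y)%E -> nice h1 -> nice h2 ->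
  (gauss_exp X b0 (fun Y => h1 Y + h2 Y)
   = gauss_exp X b0 h1 + gauss_exp X b0 h2)%E.
Proof. by move=> h10 h20 n1 n2; exact: itintD. Qed.

Lemma gauss_exp_sum (J : Type) (r : seq J) (P : pred J)
    (h : J -> ('I_n -> R) -> \bar R) :
  (forall k Y, 0 <= h k Y)%E -> (forall k, nice (h k)) ->
  (gauss_exp X b0 (fun Y => \sum_(k <- r | P k) h k Y)
   = \sum_(k <- r | P k) gauss_exp X b0 (h k))%E.
Proof. by move=> h0 nh; exact: itint_sum. Qed.

Lemma le_gauss_exp (h1 h2 : ('I_n -> R) -> \bar R) :
  (forall Y, 0 <= h1 Y)%E -> (forall Y, h1 Y <= h2 Y)%E ->
  (gauss_exp X b0 h1 <= gauss_exp X b0 h2)%E.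
Proof. by move=> h10 h12; apply: le_itint. Qed.

(** The exponential of the inner product factorizes over coordinates, and each factor integrates to
    a normal moment generating function. *)
Lemma gauss_exp_expR (v : 'I_n -> R) :
  (gauss_exp X b0 (fun Y => (expR (dot Y v))%:E)
   <= (expR (dot (mxv X b0) v + l2sq v / 2))%:E)%E.
Proof.
pose g (j : 'I_n) (y : R) := expR (v j * y).
pose c (j : 'I_n) := expR (mxv X b0 j * v j + v j ^+ 2 / 2).
have mg j : measurable_fun [set: R] (g j).
  by apply: measurableT_comp => //; exact: measurable_funM.
have := @itint_prod_le R _ _ pdf_ge0 measurable_pdf (enum 'I_n) g c (fun=> 0)
  (fun j y => expR_ge0 _) mg (fun j => expR_ge0 _) (enum_uniq _).
rewrite /gauss_exp (_ : (fun b => _) = (fun Y => (expR (dot Y v))%:E)); last first.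
  apply/funext => Y; rewrite -expR_sum /dot; congr (expR _)%:E.
  by apply: eq_bigr => j _; rewrite mulrC.
move=> H; apply: le_trans (H _) _; first by move=> j _; rewrite normal_mgf.
rewrite [X in _ * X]big1 ?mulr1; last by move=> j; rewrite mem_enum.
rewrite big_enum -expR_sum lee_fin ler_expR big_split/= lerD2l.
by rewrite /l2sq mulr_suml.
Qed.

Lemma gauss_exp_cst (k : R) : 0 <= k -> (gauss_exp X b0 (fun=> k%:E) <= k%:E)%E.
Proof.
move=> k0; have dot0 (u : 'I_n -> R) : dot u (fun=> 0) = 0.
  by rewrite /dot big1// => j _; rewrite mulr0.
(* Writing a constant as a multiple of the exponential at [v = 0] bounds the total mass by 1. *)
have -> : (fun=> k%:E)
    = (fun Y : 'I_n -> R => k%:E * (expR (dot Y (fun=> 0)))%:E)%E.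
  by apply/funext => Y; rewrite dot0 expR0 mule1.
rewrite gauss_expZl//; last exact: nice_expR_dot.
rewrite -[leRHS]mule1 lee_wpmul2l//; apply: le_trans (gauss_exp_expR _) _.
by rewrite dot0 /l2sq big1 ?mul0r ?addr0 ?expR0// => j _; rewrite expr0n.
Qed.

Variables (S : {set 'I_p}) (M : 'I_p -> 'I_p -> R) (lam : R).
Hypothesis HM : forall i k, k \in S ->
  \sum_j X j k * (X j i - \sum_(l in S) X j l * M l i) = 0.
Hypothesis b0S : forall k, k \notin S -> b0 k = 0.
Hypothesis lam0 : 0 < lam.

(** As [b0] is supported in [S], the mean is orthogonal to the residual, and the normalization
    cancels the moment generating function. *)
Lemma gauss_exp_tilt b : (gauss_exp X b0 (fun Y => (tilt X S M Y b)%:E) <= 1)%E.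
Proof.
set v := residv X S M b.
have -> : (fun Y => (tilt X S M Y b)%:E)
    = (fun Y => (expR (- (l2sq v / 2)))%:E * (expR (dot Y v))%:E)%E.
  by apply/funext => Y; rewrite -EFinM -expRD addrC.
rewrite gauss_expZl ?expR_ge0//; last exact: nice_expR_dot.
apply: (@le_trans _ _ ((expR (- (l2sq v / 2)))%:E * (expR (l2sq v / 2))%:E)%E).
  rewrite lee_wpmul2l ?lee_fin ?expR_ge0//; apply: le_trans (gauss_exp_expR _) _.
  by rewrite dot_residv// add0r.
by rewrite -EFinM -expRD addNr expR0.
Qed.

(** Taking the expectation in [Y] first replaces [tilt] by 1; what remains is a product of Laplace
    tilts, each costing a factor 2. *)
Lemma gauss_exp_majorant (T : {set 'I_p}) : T \subset ~: S ->
  (gauss_exp X b0 (fun Y =>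
     itint (fun=> laplace lam) (enum T) (fun b => (majorant X S M lam Y b)%:E)
       (fun=> 0%R))
   <= (2 ^+ #|T| * (expR 1 + 1))%:E)%E.
Proof.
move=> TS; rewrite /gauss_exp (@itint_itint _ _ _ _ _ _ _
  (fun Y b => (majorant X S M lam Y b)%:E))//; last 4 first.
- by move=> _ x; exact: laplace_ge0.
- by move=> _; exact: measurable_laplace.
- by move=> Y b; rewrite lee_fin majorant_ge0.
- exact: nice2_majorant.
have e0 : 0 <= expR 1 + 1 :> R by rewrite addr_ge0 ?expR_ge0.
(* The value 1 on [S] makes the product over all coordinates equal to the exponential of the norm on
   the complement of [S]. *)
pose g (i : 'I_p) (x : R) := if i \in S then 1 else expR (lam / 2 * `|x|).
apply: (@le_trans _ _ (itint (fun=> laplace lam) (enum T)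
    (fun b => (expR 1 + 1)%:E * (\prod_i g i (b i))%:E)%E (fun=> 0))).
  apply: le_itint.
  - by move=> _ x; exact: laplace_ge0.
  - by move=> b _; apply: itint_ge0 => // Y _; rewrite lee_fin majorant_ge0.
  move=> b _; rewrite -/(gauss_exp X b0 _).
  have -> : \prod_i g i (b i) = expR (lam / 2 * l1on (~: S) b).
    rewrite /l1on mulr_sumr expR_sum (bigID (mem S))/= big1 ?mul1r; last first.
      by move=> i iS; rewrite /g iS.
    apply: eq_big => i; first by rewrite inE.
    by move=> /negbTE iS; rewrite /g iS.
  set E := expR (lam / 2 * _); have E0 : 0 <= E by exact: expR_ge0.
  have -> : (fun Y => (majorant X S M lam Y b)%:E)
      = (fun Y => (E * expR 1)%:E * (tilt X S M Y b)%:E + E%:E)%E.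
    by apply/funext => Y; rewrite -EFinM -EFinD /majorant -/E mulrDr mulr1 mulrA.
  have nt : nice (fun Y => (tilt X S M Y b)%:E).
    exact: (@nice2l _ _ _ (fun Y b => (tilt X S M Y b)%:E) b (@nice2_tilt _ _ X S M)).
  have Ee0 : 0 <= E * expR 1 by rewrite mulr_ge0 ?expR_ge0.
  rewrite gauss_expD//; last 2 first.
  - by move=> Y; rewrite mule_ge0 ?lee_fin ?expR_ge0.
  - by move=> d' T' f cf; apply: emeasurable_funM => //; exact: nt.
  rewrite gauss_expZl//.
  apply: (@le_trans _ _ ((E * expR 1)%:E * 1 + E%:E)%E).
    by rewrite leeD ?gauss_exp_cst// lee_wpmul2l ?lee_fin// gauss_exp_tilt.
    by rewrite mule1 -EFinD -EFinM lee_fin mulrDl mul1r mulrC.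
  by move=> Y; rewrite lee_fin expR_ge0.
have mg i : measurable_fun [set: R] (g i).
  rewrite /g; case: (i \in S); first exact: measurable_cst.
  by apply: measurableT_comp => //; exact: measurable_funM.
have g0 i x : 0 <= g i x by rewrite /g; case: ifP => // _; exact: expR_ge0.
have l0 (i : 'I_p) x : 0 <= laplace lam x by exact: laplace_ge0.
have ml (i : 'I_p) := measurable_laplace lam.
rewrite [X in (X <= _)%E](_ : _ = (expR 1 + 1)%:E * itint (fun=> laplace lam) (enum T)
    (fun b => (\prod_i g i (b i))%:E) (fun=> 0%R))%E; last first.
  apply: (@itintZl _ _ _ l0 ml _ (fun b => (\prod_i g i (b i))%:E)) => //.
    by move=> b; rewrite lee_fin prodr_ge0.
  move=> d' T' f cf; apply/measurable_EFinP; apply: measurable_prod => i _.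
  exact: measurableT_comp.
rewrite mulrC EFinM lee_wpmul2l ?lee_fin//.
apply: le_trans
  (@itint_prod_le R _ _ l0 ml (enum T) g (fun=> 2) (fun=> 0) g0 mg _ _ _) _ => //.
- exact: enum_uniq.
- move=> i; rewrite mem_enum => /(fintype.subsetP TS); rewrite inE => /negbTE iS.
  by rewrite /g iS; exact: laplace_tilt.
(* The coordinates outside [T] are frozen at 0, where [g] is 1. *)
rewrite [X in _ * X]big1 ?mulr1; last first.
  by move=> i _; rewrite /g normr0 mulr0 expR0 if_same.
by rewrite big_enum prodr_const.
Qed.

End Gauss.
End Expectations.

(** * The posterior mass of strict supersets *)

Section PosteriorBound.
Context (R : realType) (n p : nat) (X : 'M[R]_(n, p)) (S0 : {set 'I_p}).
Variables (M : 'I_p -> 'I_p -> R) (lam : R).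
Hypothesis HM : forall i k, k \in S0 ->
  \sum_j X j k * (X j i - \sum_(l in S0) X j l * M l i) = 0.
Hypothesis lam0 : 0 < lam.

Local Notation lap := (fun _ : 'I_p => laplace lam).

Let lap_ge0 (i : 'I_p) (x : R) : 0 <= laplace lam x.
Proof. exact: laplace_ge0. Qed.

Let mlap (i : 'I_p) : measurable_fun [set: R] (laplace lam).
Proof. exact: measurable_laplace. Qed.

Lemma lik_ge0 Y (b : 'I_p -> R) : 0 <= lik X Y b.
Proof. exact: expR_ge0. Qed.

Lemma nice_lik Y : nice (fun b => (lik X Y b)%:E).
Proof. by move=> d T f cf; apply/measurable_EFinP; exact: measurable_lik. Qed.

Lemma laplace_shift (c x : R) :
  laplace lam (x + c) <= expR (lam * `|c|) * laplace lam x.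
Proof.
rewrite /laplace mulrCA ler_pM2l ?divr_gt0// -expRD ler_expR.
have h : `|x| <= `|x + c| + `|c| by rewrite -{1}(addrK c x) ler_normB.
by have := ler_wpM2l (ltW lam0) h; lra.
Qed.

(** The marginal likelihood of the model [S]. *)
Definition model_int Y (S : {set 'I_p}) : \bar R :=
  itint lap (enum S) (fun b => (lik X Y b)%:E) (fun=> 0).

(** For typical [Y] and [T] disjoint from [S0], a bound on the Bayes factor of the union of [S0] and
    [T] against [S0]. *)
Definition bayes_bound Y (T : {set 'I_p}) : \bar R :=
  itint lap (enum T) (fun b => (majorant X S0 M lam Y b)%:E) (fun=> 0).

Lemma model_int_ge0 Y S : (0 <= model_int Y S)%E.
Proof. by apply: itint_ge0 => // b _; rewrite lee_fin lik_ge0. Qed.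

Lemma bayes_bound_ge0 Y T : (0 <= bayes_bound Y T)%E.
Proof. by apply: itint_ge0 => // b _; rewrite lee_fin majorant_ge0. Qed.

(** With the coordinates off [S0] frozen at [b], those in [S0] are translated by [coefs]: the
    likelihood yields the factor [tilt], and the prior density pays the exponential by the triangle
    inequality. *)
Lemma model_int_shift Y (b : 'I_p -> R) :
  (itint lap (enum S0) (fun b => (lik X Y b)%:E) b
   <= (expR (lam * l1on S0 (coefs S0 M b)) * tilt X S0 M Y b)%:E
      * model_int Y S0)%E.
Proof.
have lik0 b' : (0 <= (lik X Y b')%:E)%E by rewrite lee_fin lik_ge0.
have := @itint_shift R _ _ lap_ge0 mlap (enum S0) _ _ (coefs S0 M b)
  (fun i => expR (lam * `|coefs S0 M b i|)) (tilt X S0 M Y b) b (fun=> 0)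
  lik0 (nice_lik Y) lik0 (nice_lik Y) (fun i => expR_ge0 _) (expR_ge0 _)
  (enum_uniq _) (fun i x => laplace_shift _ x).
rewrite big_enum/= -expR_sum -mulr_sumr mulrC; apply => u.
rewrite -EFinM lee_fin.
have -> : (fun j => if j \in enum S0 then u j + coefs S0 M b j else b j)
    = glue S0 (fun j => u j + coefs S0 M b j) b.
  by apply/funext => j; rewrite mem_enum.
have -> : (fun j => if j \in enum S0 then u j else 0) = glue S0 u (fun=> 0).
  by apply/funext => j; rewrite mem_enum.
by rewrite (lik_glue HM).
Qed.

Variable c0 : R.
Hypothesis phi_ge : (c0%:E <= phiS X S0)%E.
Hypothesis c0_gt0 : 0 < c0.
Hypothesis N0 : 0 < colnorm X.
Hypothesis lam_le : lam <= 2 * lambar X.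
Hypothesis small :
  16 * (#|S0|%:R * lam * Num.sqrt (ln p%:R) / colnorm X) <= c0 ^+ 2.

(** When the mean lies in the span of the columns in [S0], the residuals see only the noise, so this
    controls the noise correlations. *)
Definition typical (Y : 'I_n -> R) :=
  forall i, i \notin S0 -> `|dot Y (resid X S0 M i)| <= lambar X.

Lemma model_int_le Y (S : {set 'I_p}) : S0 \subset S -> typical Y ->
  (model_int Y S <= model_int Y S0 * bayes_bound Y (S :\: S0))%E.
Proof.
move=> S0S tY; set T := S :\: S0.
(* The coordinates in [S0] are integrated innermost, with those in [T] frozen. *)
have -> : model_int Y S
    = itint lap (enum T) (itint lap (enum S0) (fun b => (lik X Y b)%:E)) (fun=> 0).
  rewrite -itint_cat; apply: perm_itint => //.
  - by move=> b; rewrite lee_fin lik_ge0.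
  - exact: nice_lik.
  - exact: enum_uniq.
  apply: uniq_perm; first exact: enum_uniq.
    rewrite cat_uniq !enum_uniq andbT/=; apply/hasPn => i.
    by rewrite !mem_enum inE => ->.
  move=> i; rewrite mem_cat !mem_enum inE.
  by have [/(fintype.subsetP S0S)->|] := boolP (i \in S0); rewrite ?orbT ?orbF.
have W0 := model_int_ge0 Y S0.
rewrite [X in (_ <= X)%E](_ : _ = itint lap (enum T)
    (fun b => model_int Y S0 * (majorant X S0 M lam Y b)%:E)%E (fun=> 0%R)).
  apply: le_itint => // b _.
    by apply: itint_ge0 => // b' _; rewrite lee_fin lik_ge0.
  apply: le_trans (model_int_shift Y b) _; rewrite muleC lee_wpmul2l// lee_fin.
  exact: (shift_cost_le _ phi_ge).
apply/esym; apply: itintZl => //.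
- by move=> b; rewrite lee_fin majorant_ge0.
- exact: (@nice2r _ _ _ (fun Y b => (majorant X S0 M lam Y b)%:E) Y
    (@nice2_majorant _ _ _ X S0 M lam)).
Qed.

(** * Posterior bounds on and off the typical event *)

Variable pi : nat -> R.
Hypothesis pi_ge0 : forall s, 0 <= pi s.

Definition weight (S : {set 'I_p}) : R := pi #|S| / 'C(p, #|S|)%:R.

Lemma weight_ge0 S : 0 <= weight S.
Proof. by rewrite divr_ge0. Qed.

Lemma evidenceE Y :
  (prior_int pi lam (fun b => (lik X Y b)%:E)
   = \sum_(S : {set 'I_p}) (weight S)%:E * model_int Y S)%E.
Proof. by []. Qed.

Lemma numerator_ge0 (B : set ('I_p -> R)) Y :
  (0 <= prior_int pi lam (fun b => ((\1_B b : R) * lik X Y b)%:E))%E.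
Proof.
apply: sume_ge0 => S _; rewrite mule_ge0 ?lee_fin ?weight_ge0// itint_ge0// => b _.
by rewrite lee_fin mulr_ge0 ?lik_ge0.
Qed.

Lemma evidence_ge0 Y : (0 <= prior_int pi lam (fun b => (lik X Y b)%:E))%E.
Proof.
rewrite evidenceE; apply: sume_ge0 => S _.
by rewrite mule_ge0 ?lee_fin ?weight_ge0// model_int_ge0.
Qed.

Lemma posterior_ge0 B Y : 0 <= posterior X pi lam B Y.
Proof. by rewrite divr_ge0 ?fine_ge0 ?numerator_ge0 ?evidence_ge0. Qed.

(** Degenerate cases are harmless: [fine] sends infinity to 0 and division by 0 gives 0, so the
    quotient is then 0. *)
Lemma posterior_le B Y (G : \bar R) : (0 <= G)%E ->
  (prior_int pi lam (fun b => ((\1_B b : R) * lik X Y b)%:E)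
   <= prior_int pi lam (fun b => (lik X Y b)%:E) * G)%E ->
  ((posterior X pi lam B Y)%:E <= G)%E.
Proof.
move=> G0; rewrite /posterior.
move: (numerator_ge0 B Y) (evidence_ge0 Y).
case: (prior_int _ _ (fun b => (lik X Y b)%:E)) => [D| |//]; last first.
  by rewrite /= invr0 mulr0.
case: (prior_int _ _ _) => [N| |//]; last by rewrite /= mul0r.
rewrite !lee_fin => N_ge0 D_ge0 /=; have [->|D_neq0] := eqVneq D 0.
  by rewrite invr0 mulr0.
have D_gt0 : 0 < D by rewrite lt_def D_neq0.
case: G G0 => [g| |//] G0; last by rewrite leey.
by rewrite -EFinM !lee_fin ler_pdivrMr// mulrC.
Qed.

Lemma posterior_le1 B Y : ((posterior X pi lam B Y)%:E <= 1)%E.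
Proof.
apply: posterior_le => //; rewrite mule1; apply: lee_sum => S _.
rewrite lee_wpmul2l ?lee_fin ?weight_ge0//; apply: le_itint => // b _.
  by rewrite lee_fin mulr_ge0 ?lik_ge0.
by rewrite lee_fin ler_piMl ?lik_ge0// indicE; case: (_ \in _).
Qed.

(** The integral for [S] only sees points supported in [S], so a model that does not strictly
    contain [S0] contributes nothing. *)
Lemma numerator_le Y :
  (prior_int pi lam
     (fun b => ((\1_[set b | S0 \proper supp b] b : R) * lik X Y b)%:E)
   <= \sum_(S : {set 'I_p} | S0 \proper S) (weight S)%:E * model_int Y S)%E.
Proof.
rewrite /prior_int big_mkcond [X in (_ <= X)%E]big_mkcond; apply: lee_sum => S _ /=.
case: ifPn => [S0S|S0S].
  rewrite lee_wpmul2l ?lee_fin ?weight_ge0//; apply: le_itint => // b _.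
    by rewrite lee_fin mulr_ge0 ?lik_ge0.
  by rewrite lee_fin ler_piMl ?lik_ge0// indicE; case: (_ \in _).
rewrite [X in (_ * X)%E](_ : _ = 0%E) ?mule0//.
rewrite (_ : itint _ _ _ _
    = itint lap (enum S) (fun b => 0 * (lik X Y b)%:E)%E (fun=> 0%R)).
  rewrite itintZl ?mul0e//; last exact: nice_lik.
  by move=> b; rewrite lee_fin lik_ge0.
apply: eq_itint => b bS; rewrite mul0e indicE memNset ?mul0r//= => S0b.
move/negP: S0S; apply; apply: (proper_sub_trans S0b).
apply/fintype.subsetP => i; rewrite inE; apply: contraNT => iS.
by rewrite bS// mem_enum.
Qed.

Variable rho : {set 'I_p} -> R.
Hypothesis rho_ge0 : forall S, 0 <= rho S.
Hypothesis weight_le : forall S : {set 'I_p}, S0 \proper S -> weight S <= weight S0 * rho S.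

Definition superset_bound (Y : 'I_n -> R) : \bar R :=
  (\sum_(S : {set 'I_p} | S0 \proper S) (rho S)%:E * bayes_bound Y (S :\: S0))%E.

Lemma superset_bound_ge0 Y : (0 <= superset_bound Y)%E.
Proof.
by apply: sume_ge0 => S _; rewrite mule_ge0 ?lee_fin// bayes_bound_ge0.
Qed.

Lemma posterior_typical Y : typical Y ->
  ((posterior X pi lam [set b | S0 \proper supp b] Y)%:E <= superset_bound Y)%E.
Proof.
move=> tY; apply: posterior_le; first exact: superset_bound_ge0.
apply: le_trans (numerator_le Y) _.
apply: (@le_trans _ _ ((weight S0)%:E * model_int Y S0 * superset_bound Y)%E).
  rewrite /superset_bound ge0_sume_distrr; last first.
    by move=> S _; rewrite mule_ge0 ?lee_fin// bayes_bound_ge0.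
  apply: lee_sum => S S0S.
  apply: (@le_trans _ _ ((weight S0 * rho S)%:E *
      (model_int Y S0 * bayes_bound Y (S :\: S0)))%E).
    apply: lee_pmul; rewrite ?lee_fin ?weight_ge0 ?model_int_ge0 ?weight_le//.
    by apply: model_int_le => //; exact: proper_sub.
  by rewrite EFinM -!muleA lee_wpmul2l ?lee_fin ?weight_ge0// muleCA.
(* The evidence is at least the contribution of the single model [S0]. *)
rewrite lee_wpmul2r ?superset_bound_ge0// evidenceE.
rewrite (bigD1 S0)//= leeDl// sume_ge0// => S _.
by rewrite mule_ge0 ?lee_fin ?weight_ge0// model_int_ge0.
Qed.

(* [t = lambar X / colnorm X ^+ 2] is the optimal Chernoff exponent for
   [dot Y (resid i) > lambar X]. *)
Definition chernoff_term (s : R) (i : 'I_p) (Y : 'I_n -> R) : R :=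
  expR (- (lambar X ^+ 2 / colnorm X ^+ 2))
  * expR (dot Y (fun j => s * (lambar X / colnorm X ^+ 2) * resid X S0 M i j)).

Lemma chernoff_term_ge0 s i Y : 0 <= chernoff_term s i Y.
Proof. by rewrite mulr_ge0 ?expR_ge0. Qed.

Lemma dotZr (u v : 'I_n -> R) c : dot u (fun j => c * v j) = c * dot u v.
Proof. by rewrite /dot mulr_sumr; apply: eq_bigr => j _; rewrite mulrCA. Qed.

(** At a violating index, the term whose sign matches that of the inner product is at least 1. *)
Lemma chernoff_atypical Y : ~ typical Y ->
  1 <= \sum_(i | i \notin S0) (chernoff_term 1 i Y + chernoff_term (-1) i Y).
Proof.
move=> /existsNP[i /not_implyP[iS]] /negP; rewrite -ltNge => Hi.
rewrite (bigD1 i)//= ler_wpDr//.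
  by apply: sumr_ge0 => k _; rewrite addr_ge0 ?chernoff_term_ge0.
have L0 : 0 <= lambar X by rewrite -(pmulr_rge0 _ (ltr0n R 2)) (le_trans _ lam_le)// ltW.
rewrite /chernoff_term -!expRD !dotZr mul1r mulN1r.
set x := dot _ _ in Hi *; set t := lambar X / colnorm X ^+ 2.
have t0 : 0 <= t by rewrite divr_ge0// sqr_ge0.
have -> : lambar X ^+ 2 / colnorm X ^+ 2 = lambar X * t.
  by rewrite expr2 -mulrA.
have /ltW/(ler_wpM2l t0) := Hi; have [x0|x0] := leP 0 x => h.
  by rewrite ger0_norm// in h; rewrite ler_wpDr ?expR_ge0// -expR0 ler_expR; lra.
by rewrite ltr0_norm// in h; rewrite ler_wpDl ?expR_ge0// -expR0 ler_expR; lra.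
Qed.

Variable b0 : 'I_p -> R.
Hypothesis b0S : forall k, k \notin S0 -> b0 k = 0.

(** The mean is orthogonal to the residual, whose norm is at most [colnorm X], so the moment
    generating function gives back at most half of the exponent. *)
Lemma gauss_exp_chernoff_term s i : s ^+ 2 = 1 ->
  (gauss_exp X b0 (fun Y => (chernoff_term s i Y)%:E)
   <= (expR (- (lambar X ^+ 2 / colnorm X ^+ 2) / 2))%:E)%E.
Proof.
move=> s1; rewrite /chernoff_term; under eq_fun do rewrite EFinM.
rewrite gauss_expZl ?expR_ge0//; last exact: nice_expR_dot.
set t := lambar X / colnorm X ^+ 2.
apply: (@le_trans _ _ ((expR (- (lambar X ^+ 2 / colnorm X ^+ 2)))%:E
    * (expR (lambar X ^+ 2 / colnorm X ^+ 2 / 2))%:E)%E); last first.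
  by rewrite -EFinM -expRD lee_fin ler_expR; lra.
rewrite lee_wpmul2l ?lee_fin ?expR_ge0//.
apply: le_trans (gauss_exp_expR X b0 _) _; rewrite lee_fin ler_expR.
rewrite dotZr (dot_resid HM _ b0S) mulr0 add0r ler_pM2r//.
have -> : l2sq (fun j => s * t * resid X S0 M i j) = t ^+ 2 * l2sq (resid X S0 M i).
  rewrite /l2sq mulr_sumr; apply: eq_bigr => j _.
  by rewrite !exprMn s1 mul1r.
apply: (@le_trans _ _ (t ^+ 2 * colnorm X ^+ 2)).
  by rewrite ler_wpM2l ?sqr_ge0// l2sq_resid.
rewrite le_eqVlt; apply/orP; left; apply/eqP; rewrite /t; field.
exact: lt0r_neq0.
Qed.

Lemma nice_chernoff_term s i : nice (fun Y => (chernoff_term s i Y)%:E).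
Proof.
move=> d T f cf; apply/measurable_EFinP; apply: measurable_funM => //.
by apply/measurable_EFinP; exact: nice_expR_dot.
Qed.

Lemma nice_bayes_bound T : nice (fun Y => bayes_bound Y T).
Proof.
apply: (@nice2l _ _ _
  (fun Y b => itint lap (enum T) (fun b => (majorant X S0 M lam Y b)%:E) b)).
apply: nice2_itint => //.
- by move=> Y b; rewrite lee_fin majorant_ge0.
- exact: nice2_majorant.
Qed.

(** For atypical [Y] the posterior is at most 1, hence at most the Chernoff sum [ch]; for typical
    [Y] it is at most [superset_bound]. Their sum dominates for every [Y], so no indicator of the
    event is integrated. *)
Lemma gauss_exp_posterior_le :
  (gauss_exp X b0 (fun Y =>
     (posterior X pi lam [set b | S0 \proper supp b] Y)%:E)
   <= (\sum_(i | i \notin S0) 2 * expR (- (lambar X ^+ 2 / colnorm X ^+ 2) / 2)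
       + \sum_(S : {set 'I_p} | S0 \proper S)
           rho S * (2 ^+ #|S :\: S0| * (expR 1 + 1)))%:E)%E.
Proof.
pose ch Y : \bar R := (\sum_(i | i \notin S0)
  ((chernoff_term 1 i Y)%:E + (chernoff_term (-1) i Y)%:E))%E.
have ch_ge0 i Y : (0 <= (chernoff_term 1 i Y)%:E + (chernoff_term (-1) i Y)%:E)%E.
  by rewrite -EFinD lee_fin addr_ge0 ?chernoff_term_ge0.
have ch0 Y : (0 <= ch Y)%E by exact: sume_ge0.
have nch i : nice (fun Y =>
    (chernoff_term 1 i Y)%:E + (chernoff_term (-1) i Y)%:E)%E.
  by move=> d T f cf; apply: emeasurable_funD; exact: nice_chernoff_term.
have nsb S : nice (fun Y => (rho S)%:E * bayes_bound Y (S :\: S0))%E.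
  by move=> d T f cf; apply: emeasurable_funM => //; exact: nice_bayes_bound.
apply: (@le_trans _ _ (gauss_exp X b0 (fun Y => ch Y + superset_bound Y)%E)).
  apply: le_gauss_exp => Y; first by rewrite lee_fin posterior_ge0.
  have [tY|/chernoff_atypical aY] := pselect (typical Y).
    by apply: le_trans (posterior_typical tY) _; rewrite leeDr.
  apply: le_trans (posterior_le1 _ _) _.
  apply: (@le_trans _ _ (ch Y)); last by rewrite leeDl ?superset_bound_ge0.
  by rewrite /ch; under eq_bigr do rewrite -EFinD; rewrite sumEFin lee_fin.
rewrite gauss_expD//; last 3 first.
- exact: superset_bound_ge0.
- exact: nice_sum.
- exact: nice_sum.
rewrite EFinD -!sumEFin; apply: leeD.
  rewrite gauss_exp_sum//; apply: lee_sum => i _.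
  rewrite gauss_expD//; try exact: nice_chernoff_term.
  - rewrite mulr_natl mulr2n EFinD.
    by apply: leeD; apply: gauss_exp_chernoff_term; rewrite ?expr1n// sqrrN expr1n.
  - by move=> Y; rewrite lee_fin chernoff_term_ge0.
  - by move=> Y; rewrite lee_fin chernoff_term_ge0.
rewrite gauss_exp_sum//; last first.
  by move=> S Y; rewrite mule_ge0 ?lee_fin// bayes_bound_ge0.
apply: lee_sum => S S0S; rewrite gauss_expZl//; last 2 first.
- by move=> Y; exact: bayes_bound_ge0.
- exact: nice_bayes_bound.
rewrite EFinM lee_wpmul2l ?lee_fin//; apply: gauss_exp_majorant => //.
by apply/fintype.subsetP => i; rewrite !inE => /andP[].
Qed.

End PosteriorBound.

(** * Summation over supersets *)

(** Both sides are the multinomial coefficient with parts [s], [m] and [p - s - m]. *)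
Lemma bin_addl (p s m : nat) : (s + m <= p)%N ->
  ('C(p, s) * 'C(p - s, m) = 'C(p, s + m) * 'C(s + m, s))%N.
Proof.
move=> smp; have sp : (s <= p)%N by rewrite (leq_trans _ smp)// leq_addr.
have mps : (m <= p - s)%N by rewrite leq_subRL.
have F0 : (0 < s`! * (m`! * (p - s - m)`!))%N by rewrite !muln_gt0 !fact_gt0.
apply/eqP; rewrite -(eqn_pmul2r F0); apply/eqP.
transitivity (p`!).
  rewrite -(bin_fact sp) -(bin_fact mps) -!mulnA; congr (_ * _)%N.
  by rewrite mulnCA.
rewrite -(bin_fact smp) -(bin_fact (leq_addr m s)) addKn subnDA.
by rewrite -!mulnA.
Qed.

(** Passing from [m] to [m + 1] multiplies ['C(s + m, m)] by [(s + m + 1) / (m + 1)], which is at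
    most [s + 1]. *)
Lemma bin_add_le (s m : nat) : ('C(s + m, s) <= s.+1 ^ m)%N.
Proof.
rewrite -[s in 'C(_, s)](addnK m) bin_sub ?leq_addl//.
elim: m => [|m IH]; first by rewrite bin0.
rewrite -(leq_pmul2l (ltn0Sn m)) addnS -mul_bin_diag/= expnS mulnA.
apply: leq_mul => //.
by rewrite mulSn addSn ltnS leq_add2l leq_pmulr.
Qed.

Lemma geometric_sum_le (R : realType) (x : R) P : 0 <= x -> x <= 1 / 2 ->
  \sum_(i < P) x ^+ i <= 2.
Proof.
move=> x0 x2; have := subrX1 x P; set s := \sum_(i < P) _ => E.
have xP : 0 <= x ^+ P by exact: exprn_ge0.
have s0 : 0 <= s by apply: sumr_ge0 => i _; exact: exprn_ge0.
have : s * x <= s * (1 / 2) by rewrite ler_wpM2l.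
by move: E; rewrite mulrBl mul1r mulrC => E; lra.
Qed.

(** Removing [S0] is injective on supersets of [S0] and lands in the subsets of size [m] of its
    complement. *)
Lemma card_supersets_le p (S0 : {set 'I_p}) m :
  (#|[set S : {set 'I_p} | (S0 \subset S) && (#|S :\: S0| == m)]|
   <= 'C(p - #|S0|, m))%N.
Proof.
have <- : #|~: S0| = (p - #|S0|)%N by rewrite cardsCs finset.setCK card_ord.
rewrite -cards_draws; set D := [set S | _].
have inj : {in D &, injective (fun S : {set 'I_p} => S :\: S0)}.
  move=> S T; rewrite !inE => /andP[S0S _] /andP[S0T _] E.
  rewrite -(finset.setID S S0) -(finset.setID T S0) E.
  by rewrite (finset.setIidPr S0S) (finset.setIidPr S0T).
rewrite -(card_in_imset inj); apply: subset_leq_card.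
apply/fintype.subsetP => T /imsetP[S SD ->].
move: SD; rewrite !inE => /andP[_ ->].
by rewrite andbT finset.setDE finset.subsetIr.
Qed.

Lemma sum_supersets_le (R : realType) p (S0 : {set 'I_p}) (f : nat -> R) :
  (forall m, 0 <= f m) ->
  \sum_(S : {set 'I_p} | S0 \proper S) f #|S :\: S0|
  <= \sum_(m < p - #|S0|) f m.+1 *+ 'C(p - #|S0|, m.+1).
Proof.
move=> f0; have S0p : (#|S0| <= p)%N by rewrite -[leqRHS]card_ord max_card.
pose P := (p - #|S0|)%N.
have cardP (S : {set 'I_p}) : S0 \proper S -> (0 < #|S :\: S0| <= P)%N.
  move=> S0S; rewrite cardsD (finset.setIidPr (proper_sub S0S)) subn_gt0 proper_card//=.
  by rewrite leq_sub2r// -[leqRHS]card_ord max_card.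
pose h (S : {set 'I_p}) : 'I_P.+1 := inord #|S :\: S0|.
(* Group by the number of added indices; strictness empties the group of size 0. *)
rewrite (partition_big h predT)//= big_ord_recl/= big1 ?add0r; last first.
  move=> S /andP[/cardP/andP[c0 cP]] /eqP/(congr1 val)/=.
  by rewrite inordK ?ltnS// => c1; rewrite c1 in c0.
apply: ler_sum => m _.
rewrite (eq_bigr (fun=> f m.+1)); last first.
  move=> S /andP[/cardP/andP[c0 cP]] /eqP/(congr1 val)/=.
  by rewrite inordK ?ltnS// => ->.
rewrite sumr_const ler_wpMn2l//.
apply: leq_trans (card_supersets_le S0 m.+1); apply: subset_leq_card.
apply/fintype.subsetP => S; rewrite !inE => /andP[S0S] /eqP/(congr1 val)/=.
have /andP[c0 cP] := cardP _ S0S.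
by rewrite inordK ?ltnS// => ->; rewrite proper_sub//= eqxx.
Qed.

Lemma prior_decay (R : realType) p (pi : nat -> R) r s m :
  0 <= r -> (forall s, (1 <= s <= p)%N -> pi s <= r * pi s.-1) ->
  (s + m <= p)%N -> pi (s + m)%N <= r ^+ m * pi s.
Proof.
move=> r0 Hpi; elim: m => [|m IH] smp; first by rewrite addn0 mul1r.
rewrite addnS in smp *; apply: le_trans (Hpi _ _) _; first by rewrite /= smp.
by rewrite exprS -mulrA ler_wpM2l// IH// ltnW.
Qed.

(** * Prior ratios of nested models *)

Section PriorRatio.
Context (R : realType) (p : nat) (S0 : {set 'I_p}) (pi : nat -> R) (r : R).
Hypothesis r0 : 0 <= r.
Hypothesis Hpi : forall s, (1 <= s <= p)%N -> pi s <= r * pi s.-1.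

(** A bound on the ratio of [weight] when [m] indices are added: the power comes from the decay of
    [pi], the binomials from the uniform choice of the support. *)
Definition prior_ratio (m : nat) : R :=
  r ^+ m * 'C(p, #|S0|)%:R / 'C(p, #|S0| + m)%:R.

Lemma prior_ratio_ge0 m : 0 <= prior_ratio m.
Proof. by rewrite divr_ge0// mulr_ge0// exprn_ge0. Qed.

Lemma weight_ratio (S : {set 'I_p}) : S0 \proper S ->
  weight pi S <= weight pi S0 * prior_ratio #|S :\: S0|.
Proof.
move=> S0S; set m := #|S :\: S0|.
have cS : #|S| = (#|S0| + m)%N.
  by rewrite /m -(cardsID S0 S) (finset.setIidPr (proper_sub S0S)).
have Sp : (#|S0| + m <= p)%N by rewrite -cS -[leqRHS]card_ord max_card.
have C0 : 0 < 'C(p, #|S0|)%:R :> R.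
  by rewrite ltr0n bin_gt0 (leq_trans _ Sp)// leq_addr.
have C1 : 0 < 'C(p, #|S0| + m)%:R :> R by rewrite ltr0n bin_gt0.
rewrite /weight cS /prior_ratio.
rewrite [leRHS](_ : _ = r ^+ m * pi #|S0| / 'C(p, #|S0| + m)%:R); last first.
  by field; rewrite !lt0r_neq0.
by rewrite ler_pM2r ?invr_gt0// (prior_decay r0 Hpi).
Qed.

(** Multiplied by the number of supersets, the binomials collapse to ['C(#|S0| + m, #|S0|)], at most
    the [m]-th power of [#|S0| + 1]. The terms are thus bounded by [K * x ^+ m]. *)
Lemma sum_ratio_le K : 0 <= K -> (#|S0|.+1)%:R * (r * 2) <= 1 / 2 ->
  \sum_(S : {set 'I_p} | S0 \proper S)
     prior_ratio #|S :\: S0| * (2 ^+ #|S :\: S0| * K)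
  <= K * (2 * ((#|S0|.+1)%:R * (r * 2))).
Proof.
move=> K0; set x := _ * (r * 2) => x2.
have x0 : 0 <= x by rewrite !mulr_ge0.
pose f m := prior_ratio m * (2 ^+ m * K).
have f0 m : 0 <= f m by rewrite !mulr_ge0 ?prior_ratio_ge0// exprn_ge0.
apply: le_trans (@sum_supersets_le R p S0 f f0) _.
(* One factor [x] is split off because at least one index is added. *)
apply: (@le_trans _ _ (\sum_(m < p - #|S0|) (K * x) * x ^+ m)); last first.
  rewrite -mulr_sumr [2 * x]mulrC [leRHS]mulrA.
  by rewrite ler_wpM2l ?mulr_ge0// geometric_sum_le.
apply: ler_sum => -[m mp] _ /=.
have smp : (#|S0| + m.+1 <= p)%N.
  by rewrite -leq_subRL// ltnW// -subn_gt0 (leq_ltn_trans _ mp).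
have C1 : 0 < 'C(p, #|S0| + m.+1)%:R :> R by rewrite ltr0n bin_gt0.
have E : f m.+1 *+ 'C(p - #|S0|, m.+1)
    = K * (r * 2) ^+ m.+1 * 'C(#|S0| + m.+1, #|S0|)%:R.
  rewrite -mulr_natr /f /prior_ratio.
  rewrite [LHS](_ : _ = K * (r * 2) ^+ m.+1
    * ('C(p, #|S0|)%:R * 'C(p - #|S0|, m.+1)%:R) / 'C(p, #|S0| + m.+1)%:R).
    rewrite -natrM bin_addl// natrM -!mulrA; congr (_ * (_ * _)).
    by rewrite mulrC divfK// lt0r_neq0.
  by rewrite exprMn; ring.
rewrite E -mulrA -mulrA -exprS ler_wpM2l// [x ^+ _]exprMn mulrC ler_wpM2r//.
  by rewrite exprn_ge0// mulr_ge0.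
by rewrite -natrX ler_nat bin_add_le.
Qed.

End PriorRatio.

(** * Rates in [p] and the conclusion *)

Lemma expR_lambar (R : realType) n p (X : 'M[R]_(n, p)) :
  0 < colnorm X -> (0 < p)%N ->
  expR (- (lambar X ^+ 2 / colnorm X ^+ 2) / 2) = (p%:R ^+ 2)^-1.
Proof.
move=> N0 p0; have lnp : 0 <= ln p%:R :> R by rewrite ln_ge0// ler1n.
rewrite /lambar !exprMn sqr_sqrtr//.
have -> : - (2 ^+ 2 * colnorm X ^+ 2 * ln p%:R / colnorm X ^+ 2) / 2
    = - (2 * ln p%:R).
  by field; exact: lt0r_neq0.
by rewrite expRN expRM_natl lnK// posrE ltr0n.
Qed.

Lemma colnorm_gt0 (R : realType) n p (X : 'M[R]_(n, p)) :
  0 < lambar X -> 0 < colnorm X.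
Proof.
move=> L0; rewrite lt_def colnorm_ge0 andbT; apply: contraTneq L0 => N0.
by rewrite /lambar N0 mulr0 mul0r ltxx.
Qed.

(** The positive part [b] of [a] lets the extra 1 in [s.+1] be absorbed by a factor 2, and
    [b <= A - 1] still holds because [1 < A]. *)
Lemma powR_decay (R : realType) (P A a : R) (s : nat) :
  1 <= P -> 1 < A -> a < A - 1 -> s%:R <= P `^ a ->
  s.+1%:R * P `^ (- A) <= 2 / P.
Proof.
move=> P1 A1 aA sa; have P0 : 0 < P by exact: lt_le_trans P1.
pose b := Num.max a 0.
have s1 : s.+1%:R <= 2 * P `^ b.
  rewrite -addn1 natrD mulr_natl mulr2n lerD//.
    by apply: le_trans sa _; rewrite ler_powR// le_max lexx.
  by rewrite -[leLHS](powRr0 P) ler_powR// le_max lexx orbT.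
apply: (@le_trans _ _ (2 * P `^ b * P `^ (- A))); first by rewrite ler_wpM2r ?powR_ge0.
rewrite -mulrA -powRD; last by rewrite (gt_eqF P0) implybT.
rewrite ler_pM2l// -(powR_inv1 (ltW P0)) ler_powR//.
have : b <= A - 1 by rewrite ge_max ltW//= subr_ge0 ltW.
lra.
Qed.

Theorem theorem4 (R : realType)
  (n p : nat -> nat)
  (X : forall k, 'M[R]_(n k, p k))
  (lam : nat -> R)
  (pi : nat -> nat -> R)
  (A1 A2 A3 A4 : R) :
  (* n, p -> oo *)
  (forall M : nat, exists N : nat, forall k, (N <= k)%N -> (M <= n k)%N) ->
  (forall M : nat, exists N : nat, forall k, (N <= k)%N -> (M <= p k)%N) ->
  (* pi_p is a probability distribution on {0, ..., p} *)
  (forall k s, 0 <= pi k s) ->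
  (forall k, \sum_(s < (p k).+1) pi k s = 1) ->
  (* Laplace scale *)
  (forall k, 0 < lam k) ->
  (forall k, colnorm (X k) / (p k)%:R <= lam k <= 2 * lambar (X k)) ->
  0 < A1 -> 0 < A2 -> 0 < A3 -> 1 < A4 ->
  (forall k s, (1 <= s <= p k)%N ->
     A1 * powR (p k)%:R (- A3) * pi k s.-1 <= pi k s
     /\ pi k s <= A2 * powR (p k)%:R (- A4) * pi k s.-1) ->
  forall (c0 : R) (a : R) (sn : nat -> nat),
  0 < c0 ->
  a < A4 - 1 ->
  (forall k, (sn k)%:R <= powR (p k)%:R a) ->
  (fun k => (sn k)%:R * lam k * Num.sqrt (ln (p k)%:R) / colnorm (X k))
    @ \oo --> (0 : R) ->
  (* sup over admissible beta0 of E Pi(S_beta strictly contains S_beta0 | Y) -> 0 *)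
  forall eps : R, 0 < eps ->
  \forall k \near \oo,
    forall b0 : 'I_(p k) -> R,
      (c0%:E <= phiS (X k) (supp b0))%E ->
      (#|supp b0| <= sn k)%N ->
      (c0%:E <= psit (X k) (lam k) A4 (supp b0))%E ->
      (gauss_exp (X k) b0
         (fun Y => (posterior (X k) (pi k) (lam k)
                      [set b | supp b0 \proper supp b] Y)%:E)
       <= eps%:E)%E.
Proof.
move=> _ hp pi_ge0 _ lam_gt0 hlam _ A2_gt0 _ A4_gt1 hpi c0 a sn c0_gt0 aA4 hsn
  hcvg eps eps0.
pose K : R := expR 1 + 1.
have K0 : 0 <= K by rewrite addr_ge0 ?expR_ge0.
(* [C / p] bounds the expectation: the summand 2 is the union bound over [p] columns with tails
   [p ^ (-2)], the rest is the geometric series. *)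
pose C : R := 2 + K * (2 * (2 * (2 * A2))).
have C_ge0 : 0 <= C by rewrite addr_ge0// !mulr_ge0// ltW.
(* The three summands ensure [C / p <= eps], a geometric ratio at most 1/2, and [p >= 1]. *)
pose B : R := C / eps + 8 * A2 + 1.
have B0 : 0 <= B.
  by rewrite addr_ge0// addr_ge0 ?divr_ge0// ?mulr_ge0// ltW.
have large : \forall k \near \oo, B < (p k)%:R.
  have [N HN] := hp (Num.bound B); exists N => // k /HN.
  by rewrite -(ler_nat R); apply: lt_le_trans; exact: archi_boundP.
have small : \forall k \near \oo,
    `|(sn k)%:R * lam k * Num.sqrt (ln (p k)%:R) / colnorm (X k)| < c0 ^+ 2 / 16.
  by apply: (cvgr0_norm_lt _ hcvg); rewrite divr_gt0// exprn_gt0.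
near=> k => b0 phi_ge s0sn _.
have pB : B < (p k)%:R by near: k.
have smallk : `|(sn k)%:R * lam k * Num.sqrt (ln (p k)%:R) / colnorm (X k)|
    < c0 ^+ 2 / 16 by near: k.
set S0 := supp b0 in phi_ge s0sn *.
have Ce : 0 <= C / eps by rewrite divr_ge0// ltW.
have A2_ge0 := ltW A2_gt0.
have p1 : 1 <= (p k)%:R :> R by rewrite /B in pB; lra.
have p_gt0 : 0 < (p k)%:R :> R by exact: lt_le_trans p1.
have /andP[_ lam_le] := hlam k.
(* Positivity of [lam] and the upper bound on it exclude a zero matrix, so divisions by [colnorm]
   are genuine. *)
have L0 : 0 < lambar (X k).
  by rewrite -(pmulr_rgt0 _ (ltr0n R 2)) (lt_le_trans (lam_gt0 k)).
have N0 := colnorm_gt0 L0.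
have smallS : 16 * (#|S0|%:R * lam k * Num.sqrt (ln (p k)%:R) / colnorm (X k))
    <= c0 ^+ 2.
  apply: (@le_trans _ _
    (16 * ((sn k)%:R * lam k * Num.sqrt (ln (p k)%:R) / colnorm (X k)))).
    rewrite ler_pM2l// ler_pM2r ?invr_gt0// ler_wpM2r ?sqrtr_ge0//.
    by rewrite ler_pM2r// ler_nat.
  by have := le_lt_trans (ler_norm _) smallk; lra.
have [M HM] := normal_equations (X k) S0.
pose r : R := A2 * powR (p k)%:R (- A4).
have r0 : 0 <= r by rewrite mulr_ge0// powR_ge0.
have b0S i : i \notin S0 -> b0 i = 0 by rewrite inE negbK => /eqP.
pose rho (S : {set 'I_(p k)}) := prior_ratio S0 r #|S :\: S0|.
have Hpi s : (1 <= s <= p k)%N -> pi k s <= r * pi k s.-1.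
  by move=> /hpi[].
apply: le_trans (@gauss_exp_posterior_le R (n k) (p k) (X k) S0 M (lam k) HM
  (lam_gt0 k) c0 phi_ge c0_gt0 N0 lam_le smallS (pi k) (pi_ge0 k) rho
  (fun S => prior_ratio_ge0 _ r0 _) (weight_ratio r0 Hpi) b0 b0S) _.
rewrite lee_fin expR_lambar//; last by rewrite -(ltr0n R).
have x_le : #|S0|.+1%:R * (r * 2) <= 2 * (2 * A2) / (p k)%:R.
  have : #|S0|.+1%:R * powR (p k)%:R (- A4) <= 2 / (p k)%:R.
    by apply: (powR_decay p1 A4_gt1 aA4); apply: le_trans (hsn k); rewrite ler_nat.
  move=> /(ler_wpM2l (mulr_ge0 (ler0n R 2) A2_ge0)); rewrite /r.
  by congr (_ <= _); ring.
have x_half : #|S0|.+1%:R * (r * 2) <= 1 / 2.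
  apply: le_trans x_le _; rewrite ler_pdivrMr//.
  by rewrite /B in pB; lra.
apply: (@le_trans _ _ (C / (p k)%:R)); last first.
  rewrite ler_pdivrMr// mulrC -ler_pdivrMr//.
  by rewrite /B in pB; lra.
rewrite /C [leRHS]mulrDl; apply: lerD.
  rewrite sumr_const -[leLHS]mulr_natr.
  apply: (@le_trans _ _ (2 * ((p k)%:R ^+ 2)^-1 * (p k)%:R)).
    rewrite ler_wpM2l ?mulr_ge0 ?invr_ge0 ?exprn_ge0 ?ler0n// ler_nat.
    by rewrite -[leqRHS]card_ord max_card.
  rewrite le_eqVlt; apply/orP; left; apply/eqP; field.
  exact: lt0r_neq0.
apply: le_trans (sum_ratio_le r0 K0 x_half) _.
rewrite -[leRHS]mulrA ler_wpM2l// -[leRHS]mulrA.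
by rewrite ler_wpM2l.
Unshelve. all: by end_near.
Qed.
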